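(* For every integer $d\ge 1$, the Hilbert series of $R_{4,8,d}$ equals the series predicted by Fröberg for $8$ general forms of degree $d$ in $4$ variables. In particular, the degree of the Hilbert series of $R_{4,8,d}$ is $2(d-1)$, and the leading coefficient equals $d$.
   Context: Let $\Bbbk$ be a field of characteristic zero. $R_{4,8,d}=\Bbbk[x_1,x_2,x_3,x_4]/(\ell_1^d,\ldots,\ell_8^d)$, where $\ell_1,\ldots,\ell_8$ are general linear forms, i.e. the statement holds for all $(\ell_1,\dots,\ell_8)$ in some nonempty Zariski open subset of the space of $8$-tuples of linear forms. The series predicted by Fröberg for $m$ general forms of degree $d$ in $n$ variables is $\left[\frac{(1-t^d)^m}{(1-t)^n}\right]$, where the brackets mean truncation at the first non-positive term: $[\sum_i c_it^i]=\sum_{i<i_0}c_it^i$ with $i_0$ the least index such that $c_{i_0}\le 0$ (no truncation if there is none). The leading coefficient of a polynomial Hilbert series is the coefficient in its top degree. *)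

(* Defs.v *)
From mathcomp Require Import all_boot all_order all_algebra.
From mathcomp Require Import boolp mpoly.

Set Implicit Arguments.
Unset Strict Implicit.
Unset Printing Implicit Defensive.

Import GRing.Theory.
Local Open Scope ring_scope.

(** * Hilbert functions of quotients of polynomial rings *)

Section HilbertFunction.
Variables (k : fieldType) (n m : nat).

Definition in_ideal (f : 'I_m -> {mpoly k[n.+1]}) (p : {mpoly k[n.+1]}) : Prop :=
  exists g : 'I_m -> {mpoly k[n.+1]}, p = \sum_(j < m) g j * f j.

Lemma in_ideal0 f : in_ideal f 0.
Proof. by exists (fun=> 0); rewrite big1 // => j _; rewrite mul0r. Qed.

Lemma in_idealD f p q : in_ideal f p -> in_ideal f q -> in_ideal f (p + q).
Proof.
move=> [g ->] [h ->]; exists (fun j => g j + h j).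
by rewrite -big_split; apply: eq_bigr => j _; rewrite mulrDl.
Qed.

Lemma in_idealZ f a p : in_ideal f p -> in_ideal f (a *: p).
Proof.
move=> [g ->]; exists (fun j => a *: g j).
by rewrite scaler_sumr; apply: eq_bigr => j _; rewrite scalerAl.
Qed.

Lemma ideal_part_subproof (f : 'I_m -> {mpoly k[n.+1]}) (i : nat) :
  exists U : {vspace dhomog n.+1 k i}, forall p, p \in U <-> in_ideal f p.
Proof.
pose P r := `[< exists U : {vspace dhomog n.+1 k i},
  \dim U = r /\ forall p, p \in U -> in_ideal f p >].
have exP : exists r, P r.
  exists 0%N; apply/asboolP; exists 0%VS; split; first exact: dimv0.
  by move=> p; rewrite memv0 => /eqP ->; exact: in_ideal0.
have ubP r : P r -> (r <= \dim {: dhomog n.+1 k i})%N.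
  by move=> /asboolP [U [<- _]]; apply: dimvS; apply: subvf.
case: (ex_maxnP exP ubP) => r /asboolP [U [dimU UI]] maxU.
exists U => p; split=> [|Ip]; first exact: UI.
have le_dim : (\dim (U + <[p]>) <= r)%N.
  apply: maxU; apply/asboolP; exists (U + <[p]>)%VS; split=> // q.
  move=> /memv_addP [u uU [v /vlineP [a ->] ->]].
  by rewrite linearD linearZ; apply: in_idealD; [apply: UI | apply: in_idealZ].
have : (U == U + <[p]>)%VS by rewrite eqEdim addvSl dimU.
by move=> /eqP ->; apply: (subvP (addvSr _ _)); apply: memv_line.
Qed.

(** The degree [i] part of the ideal generated by [f]. *)
Definition ideal_part (f : 'I_m -> {mpoly k[n.+1]}) (i : nat)
  : {vspace dhomog n.+1 k i} := sval (cid (ideal_part_subproof f i)).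

Lemma ideal_partP f i (p : dhomog n.+1 k i) :
  p \in ideal_part f i <-> in_ideal f p.
Proof. exact: (svalP (cid (ideal_part_subproof f i))). Qed.

(** [i |-> dim_k R_i] for the graded ring [R = k[x_0, ..., x_n] / (f_j)_j]
    (the [f_j] being homogeneous), where [R_i = S_i / I_i]; the lemma
    [hilbert_fun_basis] below describes it through bases of [R_i]. *)
Definition hilbert_fun (f : 'I_m -> {mpoly k[n.+1]}) (i : nat) : nat :=
  \dim {: dhomog n.+1 k i} - \dim (ideal_part f i).

Lemma hilbert_fun_basis f i :
  exists b : (hilbert_fun f i).-tuple (dhomog n.+1 k i),
    forall p : dhomog n.+1 k i, exists! c : {ffun 'I_(hilbert_fun f i) -> k},
      in_ideal f (p - \sum_(j < hilbert_fun f i) c j *: tnth b j : dhomog _ _ _).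
Proof.
set I := ideal_part f i; pose W := (I^C)%VS.
have dimW : \dim W = hilbert_fun f i by rewrite dimv_compl.
have capW : (I :&: W = 0)%VS by apply: capv_compl.
rewrite -dimW; exists (vbasis W) => p.
have WE v : v \in W -> v = \sum_j coord (vbasis W) j v *: tnth (vbasis W) j.
  move=> vW; rewrite [LHS](coord_vbasis vW).
  by apply: eq_bigr => j _; rewrite (tnth_nth 0).
have inW (c : 'I_(\dim W) -> k) : \sum_j c j *: tnth (vbasis W) j \in W.
  by apply: rpred_sum => j _; apply: rpredZ; apply: vbasis_mem; apply: mem_tnth.
have : p \in (I + W)%VS by rewrite addv_complf memvf.
move=> /memv_addP [u uI [w wW ->]].
exists [ffun j => coord (vbasis W) j w]; split.
  apply/ideal_partP; under eq_bigr do rewrite ffunE.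
  by rewrite -WE // addrK.
move=> c /ideal_partP Ic.
set s := \sum_j _ in Ic.
have ws : w - s \in (I :&: W)%VS.
  rewrite memv_cap; apply/andP; split; last exact: memvB (inW _).
  rewrite -[w - s](addKr u).
  by apply: memvD; [rewrite memvN | rewrite addrA].
move: ws; rewrite capW memv0 subr_eq0 => /eqP ws.
apply/ffunP => j; rewrite ffunE ws /s.
under eq_bigr do rewrite (tnth_nth 0).
by rewrite coord_sum_free // (basis_free (vbasisP _)).
Qed.

End HilbertFunction.

(** * General linear forms *)

(** Row [j] of [A] lists the coefficients of the [j]-th linear form, so that
    ['M[k]_(m, n)] is the affine space of [m]-tuples of linear forms. *)
Definition linear_form (k : fieldType) (m n : nat) (A : 'M[k]_(m, n)) (j : 'I_m)
  : {mpoly k[n]} := \sum_(i < n) A j i *: 'X_i.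

Definition zariski_open (k : fieldType) (m n : nat) (U : 'M[k]_(m, n) -> Prop)
  : Prop :=
  exists F : {mpoly k[m * n]} -> Prop,
    forall A, U A <-> exists2 f, F f & f.@[fun i => mxvec A 0 i] != 0.

Definition general (k : fieldType) (m n : nat) (Q : 'M[k]_(m, n) -> Prop) : Prop :=
  exists U : 'M[k]_(m, n) -> Prop,
    [/\ zariski_open U, exists A, U A & forall A, U A -> Q A].

(** * Fröberg's series *)

(** Formal power series over [int] are given by their coefficient sequences. *)
Definition ps_mul (a b : nat -> int) (i : nat) : int :=
  \sum_(j < i.+1) a j * b (i - j)%N.

Definition ps_exp (a : nat -> int) (e : nat) : nat -> int :=
  iter e (ps_mul a) (fun i => (i == 0%N)%:R).

(** [(1 - t^d)^m / (1 - t)^n], where [1 / (1 - t) = 1 + t + t^2 + ...] *)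
Definition froberg_ratio (n m d : nat) : nat -> int :=
  ps_mul (fun i => ((1 - 'X^d) ^+ m : {poly int})`_i) (ps_exp (fun=> 1) n).

(** Truncation at the first non-positive term. *)
Definition truncate (c : nat -> int) (i : nat) : int :=
  if [forall j : 'I_i.+1, 0 < c j] then c i else 0.

Definition froberg (n m d : nat) : nat -> int := truncate (froberg_ratio n m d).

(* Main.v *)
Require Import Defs.
From HB Require Import structures.
From mathcomp Require Import all_boot all_order all_algebra.
From mathcomp Require Import boolp mpoly.
From mathcomp Require Import ring zify.

(** The conditions for the Hilbert function to be the expected one are open, so it
    is enough to check them at one point. By apolarity, a functional on degree [i]
    forms killed by the ideal of the [l_j ^ d] is a form [F] of degree [i] which has
    degree less than [d] along each line of direction [a_j], where [a_j] is the
    coefficient vector of [l_j]. We choose the eight points [a_j] in pairs on the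
    quadrilateral of lines [X_0 X_2 = X_1 X_3 = 0]. If [F] has degree at least [2 m],
    where [m = d - 1], then its restriction to a side is a multiple of the [m]-th
    power of the equation of the two points there. On a plane containing two sides,
    subtracting a multiple of the [m]-th power of a conic leaves something divisible
    by both sides, so by induction the restriction of [F] is a polynomial in the
    product of the sides and the conic. The expressions on the planes [X_0 = 0] and
    [X_2 = 0] agree on the line [X_0 = X_2 = 0] only if both reduce to a multiple of
    [(X_1 X_3) ^ m]; subtracting it leaves something divisible by [X_0 X_2], and
    induction on [m] shows that [F] is a combination of the [d] products
    [(X_0 X_2) ^ j (X_1 X_3) ^ (m - j)]. Hence [I_(2d-2)] has codimension at most
    [d], which forces the [l_j ^ d] to have no linear syzygies in degrees up to
    [2d-2], and [I_(2d-1)] is everything. *)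

Set Implicit Arguments.
Unset Strict Implicit.
Unset Printing Implicit Defensive.

Import GRing.Theory.
Local Open Scope ring_scope.

(** * Degree along a direction *)

Section Morphisms.
Variables (n : nat) (R : comNzRingType).

Lemma rmorph_mmap (S T : comNzRingType) (u : {rmorphism S -> T})
    (f : {rmorphism R -> S}) (f' : R -> T) (h : 'I_n -> S) (h' : 'I_n -> T) p :
  (forall c, u (f c) = f' c) -> (forall i, u (h i) = h' i) ->
  u (mmap f h p) = mmap f' h' p.
Proof.
move=> uf uh; rewrite /mmap rmorph_sum; apply: eq_bigr => b _.
rewrite rmorphM uf /mmap1 rmorph_prod; congr (_ * _).
by apply: eq_bigr => i _; rewrite rmorphXn uh.
Qed.

End Morphisms.

(** [F(x + T a)] as a polynomial in [T]. *)
HB.lock Definition shift (k : fieldType) (n : nat) (a : 'I_n -> k) :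
    {mpoly k[n]} -> {poly {mpoly k[n]}} :=
  mmap (polyC \o @mpolyC n k) (fun i => ('X_i)%:P + (a i)%:MP%:P * 'X).

(** One more than the degree of [F] along [a], and zero for [F = 0]; a bound by [d] thus says that
    the degree is less than [d]. *)
Local Notation dirsize a F := (size (shift a F)).

Section Directions.
Variables (k : fieldType) (n : nat).
Implicit Types (F G : {mpoly k[n]}) (a : 'I_n -> k).

Fact shift_is_zmod_morphism a : zmod_morphism (shift a).
Proof. by rewrite unlock; exact: raddfB. Qed.

Fact shift_is_monoid_morphism a : monoid_morphism (shift a).
Proof. by rewrite unlock; split; [exact: rmorph1 | exact: rmorphM]. Qed.

HB.instance Definition _ a :=
  GRing.isZmodMorphism.Build _ _ (shift a) (shift_is_zmod_morphism a).
HB.instance Definition _ a :=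
  GRing.isMonoidMorphism.Build _ _ (shift a) (shift_is_monoid_morphism a).

Lemma shiftX a i : shift a 'X_i = ('X_i)%:P + (a i)%:MP%:P * 'X.
Proof. by rewrite unlock mmapX mmap1U. Qed.

Lemma shiftB a F G : shift a (F - G) = shift a F - shift a G.
Proof. exact: rmorphB. Qed.

Lemma shiftXn a F m : shift a (F ^+ m) = shift a F ^+ m.
Proof. exact: rmorphXn. Qed.

Lemma shiftC a c : shift a c%:MP = c%:MP%:P.
Proof. by rewrite unlock mmapC. Qed.

Lemma shiftZ a c F : shift a (c *: F) = c%:MP%:P * shift a F.
Proof. by rewrite unlock mmapZ. Qed.

Lemma shift_inj a F : shift a F = 0 -> F = 0.
Proof.
rewrite unlock => sF.
(* Evaluation at [T = 0] recovers [F] from [F(x + T a)]. *)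
have /= := @rmorph_mmap n k _ _ (horner_eval (0 : {mpoly k[n]}))
  (polyC \o @mpolyC n k) (@mpolyC n k)
  (fun i => ('X_i)%:P + (a i)%:MP%:P * 'X) (fun i => 'X_i) F.
rewrite sF rmorph0 => ->.
- rewrite [LHS]mpolyE; apply: eq_bigr => b _.
  by rewrite mul_mpolyC /mmap1 -mpolyXE_id.
- by move=> c; rewrite /horner_eval /= hornerC.
- by move=> i; rewrite /horner_eval !hornerE.
Qed.

Lemma dirsizeB a F G m : (dirsize a F <= m)%N -> (dirsize a G <= m)%N ->
  (dirsize a (F - G) <= m)%N.
Proof.
move=> sF sG; rewrite rmorphB (leq_trans (size_polyD _ _)) //.
by rewrite size_polyN geq_max sF.
Qed.

Lemma dirsizeZ a c F : (dirsize a (c *: F)%R <= dirsize a F)%N.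
Proof.
by rewrite shiftZ mul_polyC; exact: size_scale_leq.
Qed.

Lemma dirsize_exp a F m : (dirsize a F <= 2)%N -> (dirsize a (F ^+ m) <= m.+1)%N.
Proof.
move=> sF; rewrite rmorphXn (leq_trans (size_poly_exp_leq _ _)) //.
by rewrite ltnS -[leqRHS]mul1n leq_mul2r -subn1 leq_subLR sF orbT.
Qed.

Lemma dirsizeX a i : dirsize a 'X_i = (a i != 0%R).+1.
Proof.
rewrite shiftX addrC size_MXaddC polyC_eq0 size_polyC mpolyC_eq0.
by rewrite -(mleadc_eq0 'X_i) mleadXm mcoeffX eqxx oner_eq0 andbF.
Qed.

(** Exactly one of [X_i], [X_j] has degree one along [a], the other has degree zero, and degrees add
    in a domain. *)
Lemma dirsizeM_var a i j G m : (a i != 0) (+) (a j != 0) ->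
  (dirsize a ('X_i * 'X_j * G) <= m.+1)%N -> (dirsize a G <= m)%N.
Proof.
move=> aij; have [->|G0] := eqVneq G 0; first by rewrite rmorph0 size_poly0.
have sG : shift a G != 0 by apply: contra_neq G0; exact: shift_inj.
have sX l : shift a 'X_l != 0 by rewrite -size_poly_gt0 dirsizeX.
rewrite !rmorphM /= size_mul ?mulf_neq0 // size_mul // !dirsizeX.
by move: aij; do 2!case: (_ == 0); rewrite //= addn2.
Qed.

End Directions.

(** * Restriction to coordinate hyperplanes *)

HB.lock Definition kill (k : fieldType) (n : nat) (s : 'I_n) :
    {mpoly k[n]} -> {mpoly k[n]} :=
  mmap (@mpolyC n k) (fun i => if i == s then 0 else 'X_i).

Section Kill.
Variables (k : fieldType) (n : nat).
Implicit Types (F G : {mpoly k[n]}) (a : 'I_n -> k).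

Fact kill_is_zmod_morphism (s : 'I_n) : zmod_morphism (@kill k n s).
Proof. by rewrite unlock; exact: raddfB. Qed.

Fact kill_is_monoid_morphism (s : 'I_n) : monoid_morphism (@kill k n s).
Proof. by rewrite unlock; split; [exact: rmorph1 | exact: rmorphM]. Qed.

HB.instance Definition _ s :=
  GRing.isZmodMorphism.Build _ _ (@kill k n s) (kill_is_zmod_morphism s).
HB.instance Definition _ s :=
  GRing.isMonoidMorphism.Build _ _ (@kill k n s) (kill_is_monoid_morphism s).

Lemma killX s i : kill s 'X_i = if i == s then 0 else 'X_i :> {mpoly k[n]}.
Proof. by rewrite unlock mmapX mmap1U. Qed.

Lemma killB s F G : kill s (F - G) = kill s F - kill s G.
Proof. exact: rmorphB. Qed.

Lemma killM s F G : kill s (F * G) = kill s F * kill s G.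
Proof. exact: rmorphM. Qed.

Lemma killXn s F m : kill s (F ^+ m) = kill s F ^+ m.
Proof. exact: rmorphXn. Qed.

Lemma kill_mpolyC s c : kill s c%:MP = c%:MP :> {mpoly k[n]}.
Proof. by rewrite unlock mmapC. Qed.

Lemma killZ s c F : kill s (c *: F) = c *: kill s F.
Proof. by rewrite unlock mmapZ mul_mpolyC. Qed.

HB.instance Definition _ s :=
  GRing.isScalable.Build k _ _ _ (@kill k n s) (fun c F => killZ s c F).

Lemma mcoeff_kill s F b : (kill s F)@_b = F@_b *+ (b s == 0%N).
Proof.
have killXm (c : 'X_{1..n}) : kill s 'X_[c] = 'X_[c] *+ (c s == 0%N) :> {mpoly k[n]}.
  rewrite unlock mmapX /mmap1; have [cs|cs] := eqVneq (c s) 0%N.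
    rewrite [RHS]mpolyXE_id; apply: eq_bigr => i _.
    by case: eqP => // ->; rewrite cs !expr0.
  by rewrite (bigD1 s) //= eqxx expr0n (negbTE cs) mul0r.
rewrite {1}(mpolyE F) rmorph_sum raddf_sum /=.
transitivity (\sum_(c <- msupp F) F@_c * (c == b)%:R *+ (b s == 0%N)).
  apply: eq_bigr => c _; rewrite killZ mcoeffZ killXm raddfMn /= mcoeffX mulrnAr.
  by have [->|] := eqVneq c b; case: (_ == _); rewrite //= ?(mulr0, mul0rn, mulr1n, mulr0n).
rewrite sumrMnl; congr (_ *+ _); rewrite [in RHS](mpolyE F) raddf_sum /=.
by apply: eq_bigr => c _; rewrite mcoeffZ mcoeffX.
Qed.

Lemma killK s F : kill s (kill s F) = kill s F.
Proof.
by apply/mpolyP => b; rewrite !mcoeff_kill; case: eqP; rewrite ?mul0rn.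
Qed.

Lemma killC s t F : kill s (kill t F) = kill t (kill s F).
Proof. by apply/mpolyP => b; rewrite !mcoeff_kill mulrnAC. Qed.

(** The direction [a] lies in the hyperplane [X_s = 0], so translation along [a] commutes with the
    restriction, which then acts on the coefficients in [T]. *)
Lemma dirsize_kill a s F : a s = 0 -> (dirsize a (kill s F) <= dirsize a F)%N.
Proof.
move=> as0; suff -> : shift a (kill s F) = map_poly (kill s) (shift a F).
  by rewrite size_poly.
rewrite [in LHS]kill.unlock [in RHS]shift.unlock.
transitivity (mmap (polyC \o @mpolyC n k)
  (fun i => shift a (if i == s then 0 else 'X_i)) F).
  by apply: rmorph_mmap => [c|i] /=; rewrite ?shiftC.
apply/esym.
pose u : {rmorphism {poly {mpoly k[n]}} -> {poly {mpoly k[n]}}} := map_poly (kill s).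
apply: (@rmorph_mmap n k _ _ u) => [c|i] /=.
  by rewrite map_polyC /= kill_mpolyC.
rewrite rmorphD rmorphM /= map_polyX !map_polyC /= killX.
rewrite kill_mpolyC.
case: eqP => [->|_]; first by rewrite as0 mpolyC0 mul0r add0r rmorph0.
by rewrite shiftX.
Qed.

(** A monomial without [X_i] or without [X_j] survives one of the restrictions, so each monomial of
    [F] contains both variables and can be divided. *)
Lemma kill_dvd (i j : 'I_n) F : i != j -> kill i F = 0 -> kill j F = 0 ->
  exists G, F = 'X_i * 'X_j * G.
Proof.
move=> ij Fi Fj.
have FE b : F@_b != 0 -> (U_(i) + U_(j) <= b)%MM.
  move=> Fb; apply/mnm_lepP => l; rewrite mnmDE !mnm1E.
  have bi : b i != 0%N.
    by apply: contra_neq Fb => bi; have := mcoeff_kill i F b; rewrite Fi bi mcoeff0.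
  have bj : b j != 0%N.
    by apply: contra_neq Fb => bj; have := mcoeff_kill j F b; rewrite Fj bj mcoeff0.
  have [<-|] := eqVneq i l; first by rewrite eq_sym (negbTE ij) addn0 lt0n.
  by have [<-|] := eqVneq j l; rewrite // lt0n.
exists (\sum_(b <- msupp F) F@_b *: 'X_[b - (U_(i) + U_(j))]).
rewrite [LHS]mpolyE mulr_sumr big_seq [RHS]big_seq; apply: eq_bigr => b.
rewrite mcoeff_msupp => /FE ib.
by rewrite -scalerAr -!mpolyXD [(_ + (b - _))%MM]addmC submK.
Qed.

End Kill.

(** * Restriction to an edge *)

(** A lower bound on degrees, instead of homogeneity, lets forms of degree [2m] and [2m + 1] be
    treated together. *)
Definition order_ge (k : fieldType) (n : nat) (m : nat) (F : {mpoly k[n]}) :=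
  forall b, (mdeg b < m)%N -> F@_b = 0.

Section Order.
Variables (k : fieldType) (n : nat).
Implicit Types (F G : {mpoly k[n]}).

Lemma order_geB m F G : order_ge m F -> order_ge m G -> order_ge m (F - G).
Proof. by move=> oF oG b bm; rewrite mcoeffB oF // oG // subr0. Qed.

Lemma order_geZ m c F : order_ge m F -> order_ge m (c *: F).
Proof. by move=> oF b bm; rewrite mcoeffZ oF // mulr0. Qed.

Lemma dhomog_order_ge m F : F \is m.-homog -> order_ge m F.
Proof. by move=> hF b bm; apply: (dhomog_nemf_coeff hF); rewrite neq_ltn bm. Qed.

Lemma order_geM_var m i j F :
  order_ge m.+2 ('X_i * 'X_j * F) -> order_ge m F.
Proof.
move=> oF b bm; have := oF (U_(i) + U_(j) + b)%MM.
by rewrite -mpolyXD mulrC mcoeffMX => ->; rewrite // !mdegD !mdeg1.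
Qed.

Lemma order_ge_kill m s F : order_ge m F -> order_ge m (kill s F).
Proof. by move=> oF b bm; rewrite mcoeff_kill oF // mul0rn. Qed.

End Order.

Section Binary.
Variable (k : fieldType).
Implicit Types (g : {mpoly k[2]}) (i : 'I_2).

(** The variable [i] becomes the outer one, so that the size measures the degree in it. *)
Definition bipol i : {mpoly k[2]} -> {poly {poly k}} :=
  mmap (polyC \o polyC) (fun j => if j == i then 'X else 'X%:P).

Lemma coef_bipol i g (b : 'X_{1..2}) : (bipol i g)`_(b i)`_(b (rev_ord i)) = g@_b.
Proof.
have bE (c : 'X_{1..2}) : (c == b) = (c i == b i) && (c (rev_ord i) == b (rev_ord i)).
  apply/eqP/andP => [->|[/eqP ci /eqP ci']]; first by rewrite !eqxx.
  apply/mnmP => l; case/orP: (orbN (l == i)) => [/eqP -> //|li].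
  suff -> : l = rev_ord i by [].
  by apply/val_inj; move: li; case: l i {ci ci'} => [[|[|]]] //= ? [[|[|]]].
rewrite /bipol /mmap !coef_sum [in RHS](mpolyE g) raddf_sum /=.
apply: eq_bigr => c _; rewrite mcoeffZ mcoeffX bE !coefCM; congr (_ * _).
have -> : mmap1 (fun j => if j == i then 'X else 'X%:P) c
    = 'X^(c i) * ('X^(c (rev_ord i)))%:P :> {poly {poly k}}.
  rewrite /mmap1 (bigD1 i) //= eqxx (bigD1 (rev_ord i)) /=; last first.
    by case: i {bE} => [[|[|]]].
  rewrite ifN; last by case: i {bE} => [[|[|]]].
  rewrite big1 ?mulr1 ?rmorphXn //=.
  by case: i {bE} => [[|[|]]] //= ? [[|[|]]].
rewrite coefMC coefXn eq_sym; case: (c i == b i); last by rewrite mul0r coef0.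
by rewrite mul1r coefXn eq_sym.
Qed.

(** In each monomial both exponents are at most [m] and their sum is at least [2m], so both equal
    [m]. *)
Lemma binary_form g m :
  order_ge m.*2 g -> (forall i, (size (bipol i g) <= m.+1)%N) ->
  exists c, g = c *: ('X_ord0 * 'X_ord_max) ^+ m.
Proof.
move=> og sg; exists g@_(U_(ord0) *+ m + U_(ord_max) *+ m)%MM.
rewrite exprMn !mpolyXn -mpolyXD.
apply/mpolyP => b; rewrite mcoeffZ mcoeffX.
case: eqP => [->|/eqP ne]; rewrite ?mulr1 ?mulr0 //.
have [gb|gb] := eqVneq g@_b 0; first by [].
have bm i : (b i <= m)%N.
  rewrite leqNgt; apply: contraNN gb => mb.
  rewrite -(coef_bipol i) [(bipol i g)`_(b i)]nth_default ?coef0 //.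
  exact: leq_trans (sg i) mb.
have db : (m.*2 <= mdeg b)%N by rewrite leqNgt; apply: contraNN gb => /og ->.
case/eqP: ne; apply/mnmP => i; rewrite mnmDE !mulmnE !mnm1E.
move: db; rewrite mdegE !big_ord_recl big_ord0 addn0.
have := bm ord0; have := bm ord_max.
have -> : lift ord0 ord0 = ord_max :> 'I_2 by apply/val_inj.
have [->|->] : i = ord0 \/ i = ord_max.
  by case: i => [[|[|]]] //= ?; [left|right]; apply/val_inj.
  by move=> /= ? ? ?; rewrite mul1n mul0n; lia.
by move=> /= ? ? ?; rewrite mul1n mul0n; lia.
Qed.

End Binary.

(** The point [al e_x + s e_y] of the edge joining [e_x] and [e_y]; it is used with [s = 1] and
    [s = -1]. *)
Definition dir (k : fieldType) (n : nat) (x y : 'I_n) (al s : k) (i : 'I_n) : k :=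
  al *+ (i == x) + s *+ (i == y).

Section Edge.
Variables (k : fieldType) (n : nat).
Implicit Types (F : {mpoly k[n]}) (a b : 'I_n -> k).

(** The substitution of [u a + v b], where the variable [i] plays [u]; the choice of [i] lets one
    bound serve both variables. *)
Definition on_plane i a b F : {mpoly k[2]} :=
  mmap (@mpolyC 2 k) (fun l => a l *: 'X_i + b l *: 'X_(rev_ord i)) F.

(** [F(T a + v b)] arises from [F(x + T a)] by substituting [x = v b] in the coefficients, which
    cannot raise the degree in [T]. *)
Lemma size_bipol_on_plane i a b F :
  (size (bipol i (on_plane i a b F)) <= dirsize a F)%N.
Proof.
pose h l : {poly {poly k}} := (a l)%:P%:P * 'X + (b l)%:P%:P * 'X%:P.
have -> : bipol i (on_plane i a b F) = mmap (polyC \o polyC) h F.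
  pose w : {rmorphism {mpoly k[2]} -> {poly {poly k}}} :=
    mmap (polyC \o polyC) (fun j => if j == i then 'X else 'X%:P).
  apply: (@rmorph_mmap n k _ _ w) => [c|l] /=.
    exact: mmapC.
  rewrite mmapD !mmapZ !mmapX !mmap1U eqxx /= ifN //.
  by case: i {w} => [[|[|]]].
pose v : {rmorphism {mpoly k[n]} -> {poly k}} := mmap polyC (fun l => (b l)%:P * 'X).
suff -> : mmap (polyC \o polyC) h F = map_poly v (shift a F) by rewrite size_poly.
rewrite shift.unlock; apply/esym.
pose u : {rmorphism {poly {mpoly k[n]}} -> {poly {poly k}}} := map_poly v.
apply: (@rmorph_mmap n k _ _ u) => [c|l] /=.
  by rewrite map_polyC /= mmapC.
rewrite rmorphD rmorphM /= map_polyX !map_polyC /= mmapC mmapX mmap1U.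
by rewrite addrC /h polyCM.
Qed.

Lemma on_plane_rev a b F : on_plane ord_max b a F = on_plane ord0 a b F.
Proof.
congr (mmap _ _ F); apply/funext => l; rewrite addrC.
by congr (_ *: 'X_ _ + _ *: 'X_ _); apply/val_inj.
Qed.

Lemma on_plane_order_ge i a b F m : order_ge m F -> order_ge m (on_plane i a b F).
Proof.
move=> oF c cm; rewrite raddf_sum /= big1_seq // => e /andP[_].
rewrite mcoeff_msupp mul_mpolyC mcoeffZ => Fe.
have me : (m <= mdeg e)%N by rewrite leqNgt; apply: contraNN Fe => /oF ->.
suff he : mmap1 (fun l => a l *: 'X_i + b l *: 'X_(rev_ord i)) e \is (mdeg e).-homog.
  by rewrite (dhomog_nemf_coeff he) ?mulr0 // neq_ltn (leq_trans cm) ?orbT.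
rewrite mdegE /mmap1; elim/big_ind2: _ => [|p r q s hp hq|l _].
- exact: dhomog1.
- exact: dhomogM.
rewrite -[X in X.-homog]mul1n; apply: dhomogMn.
by apply: rpredD; apply: rpredZ; rewrite dhomogX /= mdeg1.
Qed.

(** In the coordinates [u], [v] for which the two given directions are the
    coordinate axes, [F] has degree at most [m] in each of [u], [v] and order at
    least [2m], hence is a multiple of [(uv)^m]. *)
Lemma edge_form (x y : 'I_n) (al : k) F m :
  x != y -> al != 0 -> 2%:R != 0 :> k ->
  F = mmap (@mpolyC n k) (fun i => if (i == x) || (i == y) then 'X_i else 0) F ->
  order_ge m.*2 F ->
  (dirsize (dir x y al 1) F <= m.+1)%N -> (dirsize (dir x y al (-1)) F <= m.+1)%N ->
  exists c, F = c *: ('X_x ^+ 2 - al ^+ 2 *: 'X_y ^+ 2) ^+ m.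
Proof.
move=> xy al0 k2 Fxy oF s1 s2.
set a := dir x y al 1 in s1; set b := dir x y al (-1) in s2.
pose g := on_plane ord0 a b F.
have [c gc] : exists c, g = c *: ('X_ord0 * 'X_ord_max) ^+ m.
  apply: binary_form => [|i]; first exact: on_plane_order_ge.
  have [->|->] : i = ord0 \/ i = ord_max.
  - by case: i => [[|[|]]] //= ?; [left|right]; apply/val_inj.
  - exact: leq_trans (size_bipol_on_plane _ _ _ _) s1.
  - rewrite /g -on_plane_rev.
    exact: leq_trans (size_bipol_on_plane _ _ _ _) s2.
(* On the edge [X_x = al (u + v)] and [X_y = u - v]; solving for [u] and [v] gives [U] and [V]. *)
pose U := 2^-1 *: (al^-1 *: 'X_x + 'X_y) : {mpoly k[n]}.
pose V := 2^-1 *: (al^-1 *: 'X_x - 'X_y) : {mpoly k[n]}.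
pose v : {rmorphism {mpoly k[2]} -> {mpoly k[n]}} :=
  mmap (@mpolyC n k) (fun j => if j == ord0 then U else V).
have vg : v g = F.
  rewrite [RHS]Fxy; apply: rmorph_mmap => [e|i]; first exact: mmapC.
  rewrite /= mmapD !mmapZ !mmapX !mmap1U /= !mul_mpolyC /a /b /dir.
  have h2 : 2^-1 + 2^-1 = 1 :> k by rewrite -mulr2n -(mulr_natl 2^-1) mulfV.
  have half p : 2^-1 *: p + 2^-1 *: p = p :> {mpoly k[n]} by rewrite -scalerDl h2 scale1r.
  have [ix|ix] := eqVneq i x; have [iy|iy] := eqVneq i y.
  - by move: xy; rewrite -ix iy eqxx.
  - rewrite /= !mulr1n !mulr0n !addr0 -scalerDr ix /U /V -scalerDr addrACA subrr addr0.
    by rewrite scalerDr half scalerA mulfV // scale1r.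
  - rewrite /= !mulr1n !mulr0n !add0r scale1r scaleN1r /U /V iy -scalerBr opprB.
    by rewrite addrC addrA subrK scalerDr half.
  - by rewrite /= !mulr0n !addr0 !scale0r addr0.
(* The factor is the one in [U V = (X_x^2 - al^2 X_y^2) / (4 al^2)]. *)
exists (c * (2^-1 * 2^-1 * (al^-1 * al^-1)) ^+ m).
rewrite -vg gc /v /= mmapZ rmorphXn rmorphM /= !mmapX !mmap1U /= mul_mpolyC.
rewrite -scalerA -exprZn; congr (_ *: _ ^+ _).
rewrite /U /V -scalerAl -scalerAr scalerA -(scalerA (2^-1 * 2^-1)); congr (_ *: _).
rewrite [LHS]mulrC -subr_sqr exprZn scalerBr scalerA; congr (_ *: _ - _).
rewrite -[LHS]scale1r; congr (_ *: _); field; exact: al0.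
Qed.

End Edge.

(** * Restriction to a plane *)

(** A binary form of degree [m] evaluated at [X] and [P]; its coefficients are a sequence on all of
    [nat], so that peeling off a term is a shift. *)
Definition bisum (k : fieldType) (S : comAlgType k) (m : nat) (c : nat -> k) (X P : S) :=
  \sum_(i < m.+1) c i *: (X ^+ i * P ^+ (m - i)).

Section Bisum.
Variables (k : fieldType) (S : comAlgType k).
Implicit Types (c : nat -> k) (X P : S).

Lemma bisum0 c X P : bisum 0 c X P = c 0%N *: 1.
Proof. by rewrite /bisum big_ord1 !expr0 mul1r. Qed.

Lemma bisumS m c X P :
  bisum m.+1 c X P = c 0%N *: P ^+ m.+1 + X * bisum m (c \o succn) X P.
Proof.
rewrite /bisum big_ord_recl expr0 mul1r mulr_sumr; congr (_ + _).
by apply: eq_bigr => i _; rewrite -scalerAr mulrA -exprS.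
Qed.

Lemma bisum_top m c X P : (forall i, (i < m)%N -> c i = 0) ->
  bisum m c X P = c m *: X ^+ m.
Proof.
move=> c0; rewrite /bisum big_ord_recr /= subnn mulr1 big1 ?add0r // => i _.
by rewrite c0 // scale0r.
Qed.

Lemma rmorph_bisum (T : comAlgType k) (u : {lrmorphism S -> T}) m c X P :
  u (bisum m c X P) = bisum m c (u X) (u P).
Proof.
rewrite /bisum rmorph_sum; apply: eq_bigr => i _.
by rewrite -!rmorphXn -rmorphM -linearZ.
Qed.

(** For [X = yz], [P = a y^2 + b z^2] and [P' = a' y^2 + b' z^2], dehomogenised
    by [t = y / z], the two sides are invariant under [t -> b / (a t)] and
    [t -> b' / (a' t)] respectively, so under [t -> (b a' / a b') t]; they are
    constant unless this ratio is a root of unity. *)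
Lemma eq_bisum_top (v w : {lrmorphism S -> k | *%R}) X P P' :
  GRing.lreg X -> v X = 0 -> w X = 0 -> v P = v P' -> v P != 0 ->
  (forall m, w P ^+ m.+1 != w P' ^+ m.+1) ->
  forall m c c', bisum m c X P = bisum m c' X P' ->
  forall i, (i < m)%N -> c i = 0 /\ c' i = 0.
Proof.
move=> X0 Xv Xw PP' Pv Pw; elim=> [//|m IHm] c c'; rewrite !bisumS => E.
(* At a zero of [X] only the terms of index 0 remain. At [v] they give [c 0 = c' 0]; at [w] the
   distinct powers force this value to be 0. Then [X] cancels and the induction applies. *)
have ev (u : {lrmorphism S -> k | *%R}) : u X = 0 ->
    c 0%N * u P ^+ m.+1 = c' 0%N * u P' ^+ m.+1.
  move=> Xu; move/(congr1 u): E.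
  by rewrite !rmorphD !rmorphM /= Xu !mul0r !addr0 !linearZ /= !rmorphXn.
have c00 : c 0%N = c' 0%N.
  by have := ev v Xv; rewrite -PP'; apply: mulIf; rewrite expf_neq0.
have c0 : c 0%N = 0.
  have /eqP := ev w Xw; rewrite -c00 -subr_eq0 -mulrBr mulf_eq0 subr_eq0.
  by rewrite (negbTE (Pw m)) orbF => /eqP.
move: E; rewrite -c00 c0 !scale0r !add0r => /X0 /IHm {}IHm.
by case=> [|i] im; [rewrite -c00 c0 | exact: IHm].
Qed.

End Bisum.

Section EdgeDegree.
Variables (k : fieldType) (n : nat).
Implicit Types (F G : {mpoly k[n]}) (x y z i j : 'I_n) (al be c : k).

Definition edge_deg (d : nat) x y al F :=
  (dirsize (dir x y al 1) F <= d)%N /\ (dirsize (dir x y al (-1)) F <= d)%N.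

Lemma edge_degB d x y al F G :
  edge_deg d x y al F -> edge_deg d x y al G -> edge_deg d x y al (F - G).
Proof. by move=> [F1 F2] [G1 G2]; split; exact: dirsizeB. Qed.

Lemma edge_degZ d x y al c F : edge_deg d x y al F -> edge_deg d x y al (c *: F).
Proof. by move=> [F1 F2]; split; exact: leq_trans (dirsizeZ _ _ _) _. Qed.

Lemma edge_deg_kill d x y al s F : s != x -> s != y ->
  edge_deg d x y al F -> edge_deg d x y al (kill s F).
Proof.
move=> /negbTE sx /negbTE sy [F1 F2].
by split; (apply: leq_trans (dirsize_kill _ _) _; first by rewrite /dir sx sy addr0).
Qed.

Lemma dir_eq0 x y al s i : x != y -> al != 0 -> s != 0 ->
  (dir x y al s i == 0) = (i != x) && (i != y).
Proof.
move=> xy al0 s0; rewrite /dir.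
have [->|_] := eqVneq i x; first by rewrite (negbTE xy) addr0 (negbTE al0).
by case: (i == y); rewrite add0r ?eqxx // (negbTE s0).
Qed.

Lemma edge_degM_var d x y al i j G : x != y -> al != 0 ->
  ((i == x) || (i == y)) (+) ((j == x) || (j == y)) ->
  edge_deg d.+1 x y al ('X_i * 'X_j * G) -> edge_deg d x y al G.
Proof.
move=> xy al0 ij [G1 G2].
split; [move: G1 | move: G2]; apply: dirsizeM_var;
  by rewrite !dir_eq0 ?oppr_eq0 ?oner_eq0 // !negb_and !negbK.
Qed.

(** It passes through the four chosen points on the edges [xy] and [xz], and restricts to each edge
    as the equation of the two points there. *)
Definition conic x y z al be : {mpoly k[n]} :=
  'X_x ^+ 2 - al ^+ 2 *: 'X_y ^+ 2 - be ^+ 2 *: 'X_z ^+ 2.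

Lemma conicC x y z al be : conic x y z al be = conic x z y be al.
Proof. by rewrite /conic addrAC. Qed.

Lemma dhomog_conic x y z al be : conic x y z al be \is 2.-homog.
Proof.
have hX i : ('X_i : {mpoly k[n]}) ^+ 2 \is 2.-homog.
  by rewrite -[X in X.-homog]mul1n; apply: dhomogMn; rewrite dhomogX /= mdeg1.
by apply: rpredB; [apply: rpredB => //|]; apply: rpredZ.
Qed.

(** The coefficient of [T^2] is the value of the conic at the direction, which is zero since the
    point lies on the conic. *)
Lemma dirsize_conic x y z al be s : uniq [:: x; y; z] -> s ^+ 2 = 1 ->
  (dirsize (dir x y al s) (conic x y z al be) <= 2)%N.
Proof.
rewrite /= !inE negb_or andbT -andbA => /and3P[xy xz yz] s2.
set a := dir x y al s.
have ax : a x = al by rewrite /a /dir eqxx (negbTE xy) addr0.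
have ay : a y = s by rewrite /a /dir eqxx [y == x]eq_sym (negbTE xy) add0r.
have az : a z = 0.
  by rewrite /a /dir [z == x]eq_sym (negbTE xz) [z == y]eq_sym (negbTE yz) addr0.
rewrite /conic !shiftB !shiftZ !shiftXn !shiftX ax ay az mpolyC0 mul0r addr0.
rewrite ![(_ ^+ 2)%:MP]rmorphXn /=.
set A := al%:MP; set B := be%:MP; set S := s%:MP.
have S2 : S ^+ 2 = 1 by rewrite /S -rmorphXn s2 rmorph1.
set X := 'X_x; set Y := 'X_y; set Z := 'X_z.
pose p := X ^+ 2 - A ^+ 2 * Y ^+ 2 - B ^+ 2 * Z ^+ 2.
pose q := 2%:R * (A * X - A ^+ 2 * S * Y).
suff -> : (X%:P + A%:P * 'X) ^+ 2 - (A ^+ 2)%:P * (Y%:P + S%:P * 'X) ^+ 2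
    - (B ^+ 2)%:P * Z%:P ^+ 2 = q%:P * 'X + p%:P.
  by rewrite size_MXaddC; case: ifP => // _; rewrite ltnS size_polyC_leq1.
have {}S2 : S%:P ^+ 2 = 1 by rewrite -polyC_exp S2.
rewrite /p /q !(polyCB, polyCM, polyC_natr).
by ring: S2.
Qed.

Lemma edge_deg_conic x y z al be m : uniq [:: x; y; z] ->
  edge_deg m.+1 x y al (conic x y z al be ^+ m).
Proof.
by move=> xyz; split; apply: dirsize_exp; apply: dirsize_conic; rewrite ?expr1n ?sqrrN ?expr1n.
Qed.

Lemma kill_conic x y z al be : uniq [:: x; y; z] ->
  kill z (conic x y z al be) = 'X_x ^+ 2 - al ^+ 2 *: 'X_y ^+ 2.
Proof.
rewrite /= !inE negb_or andbT -andbA => /and3P[xy xz yz].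
rewrite /conic !killB !killZ !killXn !killX eqxx (negbTE xz) (negbTE yz).
by rewrite expr0n scaler0 subr0.
Qed.

End EdgeDegree.

Section Plane.
Variables (k : fieldType).
Hypothesis k2 : 2%:R != 0 :> k.
Implicit Types (F G : {mpoly k[4]}) (s x y z : 'I_4).

Lemma mpolyXX_neq0 y z : 'X_y * 'X_z != 0 :> {mpoly k[4]}.
Proof. by rewrite mulf_neq0 // -mleadc_eq0 mleadXm mcoeffX eqxx oner_eq0. Qed.

Lemma kill2_mmap s z x y F : uniq [:: s; x; y; z] -> kill s F = F -> kill z F = F ->
  F = mmap (@mpolyC 4 k) (fun i => if (i == x) || (i == y) then 'X_i else 0) F.
Proof.
move=> u Fs Fz.
have ks : kill s F = mmap (@mpolyC 4 k) (fun i => if i == s then 0 else 'X_i) F.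
  by rewrite kill.unlock.
rewrite -{1}Fz -{1}Fs ks.
apply: (@rmorph_mmap 4 k _ _ (@kill k 4 z)) => [c|i] /=; first exact: kill_mpolyC.
(* Four distinct indices exhaust ['I_4], as a fifth would exceed its cardinality. *)
have : i \in [:: s; x; y; z].
  rewrite -[_ \in _]negbK; apply/negP => iN.
  have ui : uniq [:: i, s, x, y & [:: z]] by rewrite [uniq _]/= iN.
  by have := max_card (mem [:: i, s, x, y & [:: z]]); rewrite (card_uniqP ui) card_ord.
move: u; rewrite /= !inE !negb_or !andbT => /and3P[/and3P[sx sy sz] /andP[xy xz] yz].
case/or4P => /eqP ->.
- by rewrite eqxx rmorph0 (negbTE sx) (negbTE sy).
- by rewrite [x == s]eq_sym (negbTE sx) eqxx killX (negbTE xz).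
- by rewrite [y == s]eq_sym (negbTE sy) eqxx orbT killX (negbTE yz).
- rewrite [z == s]eq_sym (negbTE sz) killX eqxx [z == x]eq_sym (negbTE xz).
  by rewrite [z == y]eq_sym (negbTE yz).
Qed.

Lemma kill_edge_form s x y z al m F : uniq [:: s; x; y; z] -> al != 0 ->
  kill s F = F -> order_ge m.*2 F -> edge_deg m.+1 x y al F ->
  exists c, kill z F = c *: ('X_x ^+ 2 - al ^+ 2 *: 'X_y ^+ 2) ^+ m.
Proof.
move=> u al0 Fs oF eF.
have [xy zx zy] : [/\ x != y, z != x & z != y].
  move: u; rewrite /= !inE !negb_or !andbT => /and3P[_ /andP[-> xz] yz].
  by rewrite eq_sym xz eq_sym yz.
have [] : edge_deg m.+1 x y al (kill z F) by apply: edge_deg_kill.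
apply: edge_form => //; last exact: order_ge_kill.
by apply: (kill2_mmap u); rewrite ?killK // killC Fs.
Qed.

(** Induction on [m]: a multiple of the [m]-th power of the conic has the same restriction as [F] to
    both edges, and the difference divided by [X_y X_z] meets the hypotheses for [m - 1]. *)
Lemma plane_form s x y z al be : uniq [:: s; x; y; z] -> al != 0 -> be != 0 ->
  forall m F, kill s F = F -> order_ge m.*2 F ->
  edge_deg m.+1 x y al F -> edge_deg m.+1 x z be F ->
  exists c, F = bisum m c ('X_y * 'X_z) (conic x y z al be).
Proof.
move=> u al0 be0.
have u' : uniq [:: s; x; z; y].
  by move: u; rewrite /= !inE [z == y]eq_sym; do ?case: (_ == _).
have [ux uy] : uniq [:: x; y; z] /\ uniq [:: x; z; y].
  by move: u u' => /= /andP[_ ->] /andP[_ ->].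
have [[sx sy sz] xy xz yz] : [/\ [/\ s != x, s != y & s != z], x != y, x != z & y != z].
  by move: u; rewrite /= !inE !negb_or !andbT => /and3P[/and3P[-> -> ->] /andP[-> ->] ->].
have X1 (c : k) (m : nat) : (c *: ('X_x ^+ 2) ^+ m).@[fun=> 1] = c :> k.
  by rewrite mevalZ !rmorphXn /= mevalXU !expr1n mulr1.
have key m F : kill s F = F -> order_ge m.*2 F ->
    edge_deg m.+1 x y al F -> edge_deg m.+1 x z be F ->
    exists c G, [/\ F = c *: conic x y z al be ^+ m + 'X_y * 'X_z * G,
      kill s G = G, order_ge m.*2 ('X_y * 'X_z * G),
      edge_deg m x y al G & edge_deg m x z be G].
  move=> Fs oF ey ez.
  have [c1 c1E] := kill_edge_form u al0 Fs oF ey.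
  have [c2 c2E] := kill_edge_form u' be0 Fs oF ez.
  (* The two edges meet at the vertex [e_x], where both restrictions must agree. *)
  have c12 : c1 = c2.
    have := killC z y F; rewrite c1E c2E !killZ !killXn !killB !killZ !killXn !killX.
    rewrite !eqxx (negbTE xy) (negbTE xz) !expr0n !scaler0 !subr0.
    by move/(congr1 (meval (fun=> 1))); rewrite !X1.
  pose F' := F - c1 *: conic x y z al be ^+ m.
  have zF : kill z F' = 0 by rewrite killB killZ killXn kill_conic // c1E subrr.
  have yF : kill y F' = 0.
    by rewrite killB killZ killXn conicC kill_conic // c2E c12 subrr.
  have sF : kill s F' = F'.
    rewrite /F' killB killZ Fs killXn /conic !killB !killZ !killXn !killX.
    by rewrite ![_ == s]eq_sym (negbTE sx) (negbTE sy) (negbTE sz).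
  have [G GE] := kill_dvd yz yF zF.
  exists c1, G; rewrite -GE; split.
  - by rewrite /F' addrC subrK.
  - apply: (mulfI (mpolyXX_neq0 y z)); rewrite -GE -[RHS]sF GE !killM !killX.
    by rewrite ![_ == s]eq_sym (negbTE sy) (negbTE sz).
  - apply: order_geB => //; apply: order_geZ; apply: dhomog_order_ge.
    by rewrite -muln2 mulnC; apply: dhomogMn; exact: dhomog_conic.
  - have := edge_degB ey (edge_degZ c1 (edge_deg_conic al be m ux)).
    rewrite -/F' GE; apply: edge_degM_var => //.
    by rewrite eqxx orbT [z == x]eq_sym (negbTE xz) [z == y]eq_sym (negbTE yz).
  - have := edge_degB ez (edge_degZ c1 (edge_deg_conic be al m uy)).
    rewrite conicC -/F' GE; apply: edge_degM_var => //.
    by rewrite eqxx orbT [y == x]eq_sym (negbTE xy) (negbTE yz).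
elim=> [|m IHm] F Fs oF ey ez; have [c [G [FE Gs oG Gy Gz]]] := key _ F Fs oF ey ez.
  exists (fun=> c); rewrite bisum0 FE expr0.
  have [G1 _] := Gy; suff -> : G = 0 by rewrite mulr0 addr0.
  by apply: (@shift_inj _ _ (dir x y al 1)); apply/eqP; rewrite -size_poly_leq0.
have [c' c'E] := IHm G Gs (order_geM_var oG) Gy Gz.
by exists (fun i => if i is i'.+1 then c' i' else c); rewrite bisumS FE c'E.
Qed.

End Plane.

(** * Gluing two planes along their common line *)

Section Space.
Variables (k : fieldType).
Hypothesis natk0 : forall n, (n%:R == 0 :> k) = (n == 0)%N.
Implicit Types (F G : {mpoly k[4]}) (p q x y z : 'I_4).

Lemma edge_deg_XX (x y : 'I_4) (al : k) i j m : x != y -> al != 0 ->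
  ((i == x) || (i == y)) (+) ((j == x) || (j == y)) ->
  edge_deg m.+1 x y al (('X_i * 'X_j) ^+ m).
Proof.
move=> xy al0 ij.
have XX a : (a i != 0) (+) (a j != 0) -> (dirsize a ('X_i * 'X_j : {mpoly k[4]}) <= 2)%N.
  move=> aij; rewrite rmorphM /= (leq_trans (size_polyMleq _ _)) // !dirsizeX.
  by move: aij; do 2!case: (_ == 0).
by split; apply/dirsize_exp/XX; rewrite !dir_eq0 ?oppr_eq0 ?oner_eq0 // !negb_and !negbK.
Qed.

(** [plane_form] describes [F] on [X_p = 0] and on [X_q = 0]. Comparison on the common line leaves
    only [(X_y X_z)^m]; subtracting it and dividing by [X_p X_q] lowers [m]. *)
Lemma space_form p q y z : uniq [:: p; q; y; z] ->
  forall m F, order_ge m.*2 F ->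
  edge_deg m.+1 q y 1 F -> edge_deg m.+1 q z 2%:R F ->
  edge_deg m.+1 p y 1 F -> edge_deg m.+1 p z 1 F ->
  exists c, F = bisum m c ('X_p * 'X_q) ('X_y * 'X_z).
Proof.
move=> u.
have u' : uniq [:: q; p; y; z].
  by move: u; rewrite /= !inE [q == p]eq_sym; do ?case: (_ == _).
have [[pq py pz] qy qz yz] : [/\ [/\ p != q, p != y & p != z], q != y, q != z & y != z].
  by move: u; rewrite /= !inE !negb_or !andbT => /and3P[/and3P[-> -> ->] /andP[-> ->] ->].
have k2 : 2%:R != 0 :> k by rewrite natk0.
have key m F : order_ge m.*2 F ->
    edge_deg m.+1 q y 1 F -> edge_deg m.+1 q z 2%:R F ->
    edge_deg m.+1 p y 1 F -> edge_deg m.+1 p z 1 F ->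
  exists c G, [/\ F = c *: ('X_y * 'X_z) ^+ m + 'X_p * 'X_q * G,
    order_ge m.*2 ('X_p * 'X_q * G),
    edge_deg m q y 1 G /\ edge_deg m q z 2%:R G &
    edge_deg m p y 1 G /\ edge_deg m p z 1 G].
  move=> oF qyF qzF pyF pzF.
  have [c cE] : exists c, kill p F = bisum m c ('X_y * 'X_z) (conic q y z 1 2%:R).
    apply: (plane_form k2 u); rewrite ?oner_eq0 ?killK //; first exact: order_ge_kill.
      exact: edge_deg_kill.
    exact: edge_deg_kill.
  have [c' cE'] : exists c, kill q F = bisum m c ('X_y * 'X_z) (conic p y z 1 1).
    apply: (plane_form k2 u'); rewrite ?oner_eq0 ?killK //; first exact: order_ge_kill.
      by apply: edge_deg_kill; rewrite // eq_sym.
    by apply: edge_deg_kill; rewrite // eq_sym.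
  have kYZ s : s != y -> s != z -> kill s ('X_y * 'X_z) = 'X_y * 'X_z :> {mpoly k[4]}.
    by move=> sy sz; rewrite killM !killX ![_ == s]eq_sym (negbTE sy) (negbTE sz).
  have kC s al be : s != y -> s != z -> kill s (conic s y z al be) =
      - al ^+ 2 *: 'X_y ^+ 2 - be ^+ 2 *: 'X_z ^+ 2 :> {mpoly k[4]}.
    move=> sy sz; rewrite /conic !killB !killZ !killXn !killX eqxx expr0n sub0r.
    by rewrite scaleNr ![_ == s]eq_sym (negbTE sy) (negbTE sz).
  have kB s (d : nat -> k) (al be : k) : s != y -> s != z ->
      kill s (bisum m d ('X_y * 'X_z) (conic s y z al be)) =
      bisum m d ('X_y * 'X_z) (- al ^+ 2 *: 'X_y ^+ 2 - be ^+ 2 *: 'X_z ^+ 2).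
    move=> sy sz; have /= := rmorph_bisum (@kill k 4 s) m d ('X_y * 'X_z) (conic s y z al be).
    by move=> E; apply: (etrans E); exact: congr2 (kYZ s sy sz) (kC s al be sy sz).
  (* The two restrictions commute, so both descriptions agree on the line [X_p = X_q = 0]. *)
  have cc : bisum m c ('X_y * 'X_z) (- 1 ^+ 2 *: 'X_y ^+ 2 - 2%:R ^+ 2 *: 'X_z ^+ 2)
      = bisum m c' ('X_y * 'X_z) (- 1 ^+ 2 *: 'X_y ^+ 2 - 1 ^+ 2 *: 'X_z ^+ 2).
    apply: etrans (esym (kB q c 1 2%:R qy qz)) _.
    apply: etrans (kB p c' 1 1 py pz); rewrite -cE -cE'; exact: killC.
  have [cm cm'] : (forall i, (i < m)%N -> c i = 0) /\ (forall i, (i < m)%N -> c' i = 0).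
    suff c0 i : (i < m)%N -> c i = 0 /\ c' i = 0 by split=> i /c0[].
    pose e (l i : 'I_4) : k := (i == l)%:R.
    have ez l : e l l = 1 by rewrite /e eqxx.
    have eN l l' : l != l' -> e l l' = 0 by rewrite /e eq_sym => /negbTE ->.
    have eE (v : 'I_4 -> k) a b : ((- a *: 'X_y ^+ 2 - b *: 'X_z ^+ 2).@[v])
        = - a * v y ^+ 2 - b * v z ^+ 2.
      by rewrite mevalB !mevalZ !rmorphXn /= !mevalXU.
    have eX (v : 'I_4 -> k) : ('X_y * 'X_z).@[v] = v y * v z.
      by rewrite mevalM !mevalXU.
    have zy : z != y by rewrite eq_sym.
    (* At [e y] both conics take the value [-1]; at [e z] their values are [-4] and [-1]. *)
    apply: (eq_bisum_top (v := meval (e y)) (w := meval (e z)) _ _ _ _ _ _ cc) => /=.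
    - exact/lregP/mpolyXX_neq0.
    - by rewrite eX (eN y z) ?mulr0.
    - by rewrite eX (eN z y) ?mul0r.
    - by rewrite !eE (eN y z) // expr0n !mulr0.
    - by rewrite eE ez (eN y z) // expr0n mulr0 !expr1n mulr1 subr0 oppr_eq0 oner_eq0.
    - move=> r; rewrite !eE ez (eN z y) // expr0n mulr0 !expr1n !mulr1 !sub0r.
      rewrite exprNn [X in _ != X]exprNn expr1n (inj_eq (mulfI _)) ?signr_eq0 //.
      (* With the common sign removed, what remains is [4^(r + 1) - 1 != 0] in characteristic
         zero. *)
      rewrite -exprM -natrX -subr_eq0 -[X in _ - X]/(1%:R) -natrB ?expn_gt0 // natk0.
      by rewrite subn_eq0 -ltnNge -{1}(expn0 2) ltn_exp2l.
  rewrite !bisum_top // in cc cE cE'.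
  have {}cc : c' m = c m.
    have X1 (a : k) : (a *: ('X_y * 'X_z) ^+ m).@[fun=> 1] = a.
      by rewrite mevalZ rmorphXn /= mevalM !mevalXU mulr1 expr1n mulr1.
    by move/(congr1 (meval (fun=> 1))): cc; rewrite !X1.
  pose F' := F - c m *: ('X_y * 'X_z) ^+ m.
  have pF : kill p F' = 0 by rewrite killB killZ killXn kYZ // cE subrr.
  have qF : kill q F' = 0 by rewrite killB killZ killXn kYZ // cE' cc subrr.
  have [G GE] := kill_dvd pq pF qF.
  have edge x al l : (x == p) || (x == q) -> (l == y) || (l == z) -> al != 0 ->
      edge_deg m.+1 x l al F -> edge_deg m x l al G.
    move=> xpq lyz al0 eF.
    have xl : x != l by case/orP: xpq => /eqP ->; case/orP: lyz => /eqP ->.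
    have := edge_degB eF (edge_degZ (c m) (@edge_deg_XX x l al y z m xl al0 _)).
    rewrite -/F' GE => eF'; apply: edge_degM_var (eF' _) => //.
      case/orP: xpq => /eqP xE; case/orP: lyz => /eqP lE; rewrite xE lE eqxx /=;
      by rewrite ?[q == p]eq_sym ?(negbTE pq) ?(negbTE py) ?(negbTE pz) ?(negbTE qy) ?(negbTE qz).
    case/orP: xpq => /eqP xE; case/orP: lyz => /eqP lE; rewrite xE lE eqxx orbT;
    by rewrite ?[_ == p]eq_sym ?[_ == q]eq_sym ?[z == y]eq_sym ?(negbTE yz)
      ?(negbTE py) ?(negbTE pz) ?(negbTE qy) ?(negbTE qz).
  exists (c m), G; rewrite -GE; split.
  - by rewrite /F' addrC subrK.
  - apply: order_geB => //; apply: order_geZ; apply: dhomog_order_ge.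
    rewrite -mul2n; apply: dhomogMn.
    by rewrite -[X in X.-homog]/(1 + 1)%N; apply: dhomogM; rewrite dhomogX /= mdeg1.
  - by split; apply: edge; rewrite ?eqxx ?orbT ?oner_eq0.
  - by split; apply: edge; rewrite ?eqxx ?orbT ?oner_eq0.
elim=> [|m IHm] F oF qyF qzF pyF pzF;
  have [c [G [FE oG [qyG qzG] [pyG pzG]]]] := key _ F oF qyF qzF pyF pzF.
  exists (fun=> c); rewrite bisum0 FE expr0.
  have [G1 _] := qyG; suff -> : G = 0 by rewrite mulr0 addr0.
  by apply: (@shift_inj _ _ (dir q y 1 1)); apply/eqP; rewrite -size_poly_leq0.
have [c' c'E] := IHm G (order_geM_var oG) qyG qzG pyG pzG.
by exists (fun i => if i is i'.+1 then c' i' else c); rewrite bisumS FE c'E.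
Qed.
End Space.

(** * Inverse systems *)

Section InverseSystem.
Variables (k : fieldType) (n : nat).
Hypothesis natk0 : forall n, (n%:R == 0 :> k) = (n == 0)%N.
Implicit Types (F G p q : {mpoly k[n]}) (a : 'I_n -> k) (c : 'X_{1..n} -> k).

Lemma mpoly_ring_ind (P : {mpoly k[n]} -> Prop) :
  (forall e, P e%:MP) -> (forall i, P 'X_i) ->
  (forall p q, P p -> P q -> P (p + q)) -> (forall p q, P p -> P q -> P (p * q)) ->
  forall p, P p.
Proof.
move=> PC PX PD PM p; rewrite [p]mpolyE; apply: (big_ind P) => [|//|b _].
  by rewrite -mpolyC0.
rewrite -mul_mpolyC; apply: (PM) => //; rewrite mpolyXE_id.
apply: (big_ind P) => [|//|i _]; first by rewrite -mpolyC1.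
by elim: (b i) => [|e IH]; rewrite ?expr0 -?mpolyC1 // exprS; exact: PM.
Qed.

Definition dirD a p : {mpoly k[n]} := \sum_i a i *: p^`M(i).

Lemma dirD0 a : dirD a 0 = 0.
Proof. by rewrite /dirD big1 // => i _; rewrite mderiv0 scaler0. Qed.

Lemma dirDD a p q : dirD a (p + q) = dirD a p + dirD a q.
Proof. by rewrite -big_split; apply: eq_bigr => i _; rewrite mderivD scalerDr. Qed.

Lemma dirDM a p q : dirD a (p * q) = dirD a p * q + p * dirD a q.
Proof.
rewrite /dirD mulr_suml mulr_sumr -big_split; apply: eq_bigr => i _.
by rewrite mderivM scalerDr scalerAl scalerAr.
Qed.

(** The chain rule: both sides satisfy the same Leibniz rule over [shift a] and agree on constants
    and variables. *)
Lemma deriv_shift a p : (shift a p)^`() = shift a (dirD a p).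
Proof.
elim/mpoly_ring_ind: p => [e|i|p q IHp IHq|p q IHp IHq].
- rewrite shiftC derivC /dirD big1 ?rmorph0 // => i _.
  by rewrite mderivC scaler0.
- rewrite shiftX derivD derivC add0r derivM derivC mul0r add0r derivX mulr1.
  rewrite /dirD (bigD1 i) //= big1 => [|j ji].
    rewrite addr0 mderivX mnm1E eqxx scale1r.
    have -> : (U_(i) - U_(i) = 0 :> 'X_{1..n})%MM.
      by apply/mnmP => j; rewrite mnmBE mnm0E subnn.
    by rewrite mpolyX0 shiftZ rmorph1 mulr1.
  by rewrite mderivX mnm1E eq_sym (negbTE ji) scale0r scaler0.
- by rewrite rmorphD /= derivD IHp IHq dirDD rmorphD.
- by rewrite rmorphM /= derivM IHp IHq dirDM rmorphD !rmorphM.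
Qed.

(** The [d]-th derivative in [T] multiplies coefficients by falling factorials, which are nonzero in
    characteristic zero. *)
Lemma size_shift_le a p d : iter d (dirD a) p = 0 -> (dirsize a p <= d)%N.
Proof.
move=> Dp; have dp : (shift a p)^`(d) = 0.
  suff -> : (shift a p)^`(d) = shift a (iter d (dirD a) p) by rewrite Dp rmorph0.
  by elim: d {Dp} => // d IH; rewrite derivnS IH deriv_shift.
apply/leq_sizeP => j dj; have := coef_derivn d (shift a p) (j - d).
rewrite dp coef0 subnKC // => /esym/eqP; rewrite -scaler_nat scaler_eq0.
rewrite natk0.
by rewrite -leqn0 leqNgt ffact_gt0 dj /= => /eqP.
Qed.

(** The polynomial of the inverse system attached to the functional [X^b |-> c b]
    in degree [e]. *)
Definition dual_poly (e : nat) c : {mpoly k[n]} :=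
  \sum_(b : 'X_{1..n < e.+1}) ((c b / (\prod_i (b i)`!)%:R) *+ (mdeg b == e)) *: 'X_[b].

Lemma mcoeff_dual_poly e c b :
  (dual_poly e c)@_b = (c b / (\prod_i (b i)`!)%:R) *+ (mdeg b == e).
Proof.
have [be|eb] := ltnP (mdeg b) e.+1.
  exact: (mcoeff_mpoly (fun b => (c b / (\prod_i (b i)`!)%:R) *+ (mdeg b == e)) be).
rewrite gtn_eqF // mulr0n /dual_poly raddf_sum big1 //= => i _.
rewrite mcoeffZ mcoeffX; have [ib|] := eqVneq (i : 'X_{1..n}) b; rewrite ?mulr0 //.
by move: (bmdeg i); rewrite ib ltnNge eb.
Qed.

(** The transpose of multiplication by the linear form with coefficients [a]; see
    [pairing_contract]. *)
Definition contract a c : 'X_{1..n} -> k := fun b => \sum_i a i * c (b + U_(i))%MM.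

(** The factorials in [dual_poly] absorb the exponents produced by differentiation, leaving a shift
    of the index. *)
Lemma dirD_dual_poly a e c :
  dirD a (dual_poly e.+1 c) = dual_poly e (contract a c).
Proof.
apply/mpolyP => b; rewrite mcoeff_dual_poly /dirD raddf_sum /= /contract.
rewrite mulr_suml -sumrMnl; apply: eq_bigr => i _.
rewrite mcoeffZ mcoeff_deriv mcoeff_dual_poly mdegD mdeg1 addn1 eqSS.
case: eqP => _; rewrite ?mulr0n ?mul0rn ?mulr0 // !mulr1n -mulrA; congr (_ * _).
rewrite -[LHS]mulr_natr -mulrA; congr (_ * _).
have -> : (\prod_j ((b + U_(i))%MM j)`! = (b i).+1 * \prod_j (b j)`!)%N.
  rewrite (bigD1 i) // [in RHS](bigD1 i) //= mnmDE mnm1E eqxx addn1 factS mulnA.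
  congr (_ * _)%N; apply: eq_bigr => j ji.
  by rewrite mnmDE mnm1E eq_sym (negbTE ji) addn0.
by rewrite natrM invfM mulrC mulrA mulfV ?mul1r // natk0.
Qed.

Lemma dirD_dual_poly0 a c : dirD a (dual_poly 0 c) = 0.
Proof.
apply/mpolyP => b; rewrite /dirD raddf_sum /= mcoeff0 big1 // => i _.
by rewrite mcoeffZ mcoeff_deriv mcoeff_dual_poly mdegD mdeg1 addn1 mul0rn mulr0.
Qed.

Lemma iter_dirD_dual_poly a d e c : iter d (dirD a) (dual_poly e c) =
  if (d <= e)%N then dual_poly (e - d) (iter d (contract a) c) else 0.
Proof.
elim: d e c => [|d IH] [|e] c; rewrite ?subn0 // iterSr.
  by rewrite dirD_dual_poly0; elim: d {IH} => //= d ->; rewrite dirD0.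
by rewrite dirD_dual_poly IH ltnS subSS -iterSr.
Qed.

(** [N] is an exclusive degree bound that makes the sum finite; each contraction moved to the other
    side raises it by one. *)
Definition pairing (N : nat) c p : k := \sum_(b : 'X_{1..n < N}) p@_b * c b.

Lemma pairingD N c p q : pairing N c (p + q) = pairing N c p + pairing N c q.
Proof. by rewrite -big_split; apply: eq_bigr => b _; rewrite mcoeffD mulrDl. Qed.

Lemma pairingZ N c e p : pairing N c (e *: p) = e * pairing N c p.
Proof. by rewrite mulr_sumr; apply: eq_bigr => b _; rewrite mcoeffZ mulrA. Qed.

Lemma pairing0 N c : pairing N c 0 = 0.
Proof. by rewrite /pairing big1 // => b _; rewrite mcoeff0 mul0r. Qed.

Lemma pairingX N c b : pairing N c 'X_[b] = c b *+ (mdeg b < N)%N.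
Proof.
rewrite /pairing; case: ltnP => bN; last first.
  rewrite big1 // => e _; rewrite mcoeffX; case: eqP => [be|]; rewrite ?mul0r //.
  by have := bmdeg e; rewrite -be ltnNge bN.
rewrite (bigD1 (BMultinom bN)) //= mcoeffX eqxx mul1r big1 ?addr0 // => e.
by rewrite mcoeffX bmeqP /= eq_sym => /negbTE ->; rewrite mul0r.
Qed.

Lemma pairing_contract N a c p :
  pairing N (contract a c) p = pairing N.+1 c ((\sum_i a i *: 'X_i) * p).
Proof.
elim/mpolyind: p => [|e b p _ _ IH]; first by rewrite mulr0 !pairing0.
rewrite mulrDr !pairingD IH; congr (_ + _).
rewrite -scalerAr !pairingZ pairingX mulr_suml; congr (_ * _).
have -> : pairing N.+1 c (\sum_i a i *: 'X_i * 'X_[b]) =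
    \sum_i pairing N.+1 c (a i *: 'X_i * 'X_[b]).
  exact: (big_morph _ (pairingD N.+1 c) (pairing0 N.+1 c)).
rewrite -sumrMnl; apply: eq_bigr => i _.
by rewrite -scalerAl -mpolyXD pairingZ pairingX mdegD mdeg1 add1n ltnS mulrnAr addmC.
Qed.

Lemma pairing_iter_contract N a d c p :
  pairing N (iter d (contract a) c) p =
  pairing (N + d)%N c ((\sum_i a i *: 'X_i) ^+ d * p).
Proof.
elim: d N c p => [|d IH] N c p; first by rewrite addn0 expr0 mul1r.
by rewrite /= pairing_contract IH addnS exprSr mulrA.
Qed.

(** Apolarity: annihilating the multiples of the [d]-th power of the linear form means that the
    [d]-th derivative along [a] vanishes. *)
Lemma dirsize_dual_poly a d e c :
  (forall b, (mdeg b + d = e)%N ->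
    pairing e.+1 c ((\sum_i a i *: 'X_i) ^+ d * 'X_[b]) = 0) ->
  (dirsize a (dual_poly e c) <= d)%N.
Proof.
move=> cb; apply: size_shift_le; rewrite iter_dirD_dual_poly; case: leqP => // de.
apply/mpolyP => b; rewrite mcoeff_dual_poly mcoeff0; case: eqP => // be.
suff -> : iter d (contract a) c b = 0 by rewrite mul0r mul0rn.
have := pairing_iter_contract (e - d).+1 a d c 'X_[b].
rewrite pairingX be ltnSn mulr1n => ->; rewrite addSn subnK //.
by apply: cb; rewrite be subnK.
Qed.

Lemma dual_poly_homog e c : dual_poly e c \is e.-homog.
Proof.
apply: rpred_sum => b _; case: (eqVneq (mdeg b) e) => [be|_].
  by rewrite rpredZ // dhomogX /= be.
by rewrite scale0r rpred0.
Qed.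

Lemma dual_poly_eq0 e c b : mdeg b = e -> (dual_poly e c)@_b = 0 -> c b = 0.
Proof.
move=> be /eqP; rewrite mcoeff_dual_poly be eqxx mulr1n mulf_eq0 invr_eq0 natk0.
have : (0 < \prod_i (b i)`!)%N by apply: prodn_gt0 => i; exact: fact_gt0.
by rewrite lt0n => /negbTE ->; rewrite orbF => /eqP.
Qed.

End InverseSystem.

(** * Openness *)

Lemma dhomog_powX (R : comNzRingType) n (l : {mpoly R[n]}) d b :
  l \is 1.-homog -> l ^+ d * 'X_[b] \is (mdeg b + d).-homog.
Proof.
move=> hl; rewrite addnC -[d in X in X.-homog]mul1n.
by apply: dhomogM; [exact: dhomogMn | rewrite dhomogX].
Qed.

Section SpanMatrix.
Variables (m n d i : nat) (w : pred 'X_{1..n}).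

(** Rows of the wrong degree and unselected monomials become zero, which keeps the index type
    independent of [w] and [d]. *)
Definition span_row (R : comNzRingType) (L : 'I_m -> {mpoly R[n]})
    (r : 'I_m * 'X_{1..n < i.+1} + 'X_{1..n < i.+1}) : {mpoly R[n]} :=
  match r with
  | inl (j, a) => (L j ^+ d * 'X_[a]) *+ (mdeg a + d == i)%N
  | inr b => 'X_[b] *+ w b
  end.

(** Having full row rank means that the degree [i] part of the ideal of the
    [L_j ^ d] and the monomials selected by [w] together span all forms, a condition
    expressed by minors. *)
Definition span_mx (R : comNzRingType) (L : 'I_m -> {mpoly R[n]}) :
    'M[R]_(#|{: 'I_m * 'X_{1..n < i.+1} + 'X_{1..n < i.+1}}|, #|{: 'X_{1..n < i.+1}}|) :=
  \matrix_(r < #|{: 'I_m * 'X_{1..n < i.+1} + 'X_{1..n < i.+1}}|,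
           s < #|{: 'X_{1..n < i.+1}}|)
    (span_row L (enum_val r))@_(enum_val s : 'X_{1..n < i.+1}).

Lemma map_span_mx (R S : comNzRingType) (f : {rmorphism R -> S}) L :
  map_mx f (span_mx L) = span_mx (fun j => map_mpoly f (L j)).
Proof.
apply/matrixP => r s; rewrite !mxE -mcoeff_map_mpoly; congr (_@__).
case: (enum_val r) => [[j a]|b] /=; rewrite raddfMn /=.
  by rewrite rmorphM rmorphXn /= map_mpolyX.
by rewrite map_mpolyX.
Qed.

(** By duality: a vector orthogonal to all rows is a functional [c] killing the ideal and the
    selected monomials, hence zero by assumption. *)
Lemma span_mx_full (k : fieldType) (L : 'I_m -> {mpoly k[n]}) :
  (forall c : 'X_{1..n} -> k,
    (forall j b, (mdeg b + d = i)%N -> pairing i.+1 c (L j ^+ d * 'X_[b]) = 0) ->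
    (forall b, (mdeg b <= i)%N -> w b -> c b = 0) ->
    forall b, (mdeg b <= i)%N -> c b = 0) ->
  row_full (span_mx L).
Proof.
move=> cP; rewrite /row_full -mxrank_tr -/(row_free _) -kermx_eq0.
apply/rowV0P => v /sub_kermxP vM.
pose c (b : 'X_{1..n}) : k :=
  if insub b is Some e then v 0 (enum_rank (e : 'X_{1..n < i.+1})) else 0.
have cE (e : 'X_{1..n < i.+1}) : c e = v 0 (enum_rank e) by rewrite /c valK.
have rowE r : pairing i.+1 c (span_row L r) = 0.
  have := congr1 (fun M : 'rV_ _ => M 0 (enum_rank r)) vM.
  rewrite !mxE => <-; rewrite /pairing.
  rewrite (reindex (@enum_val {: 'X_{1..n < i.+1}} predT)) /=; last exact/onW_bij/enum_val_bij.
  by apply: eq_bigr => s _; rewrite !mxE enum_rankK cE enum_valK mulrC.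
have c0 : forall b, (mdeg b <= i)%N -> c b = 0.
  apply: cP => [j b bd|b bi wb].
    have bi : (mdeg b < i.+1)%N by rewrite ltnS -bd leq_addr.
    by have := rowE (inl (j, BMultinom bi)); rewrite /= bd eqxx.
  by have := rowE (inr (BMultinom (bi : (mdeg b < i.+1)%N))); rewrite /= wb pairingX ltnS bi.
apply/rowP => s; rewrite mxE -(enum_valK s) -cE c0 //.
by have := bmdeg (enum_val s); rewrite ltnS.
Qed.

Lemma span_mx_fullP (k : fieldType) (L : 'I_m -> {mpoly k[n]}) :
  (forall j, L j \is 1.-homog) -> (forall b, w b -> (mdeg b <= i)%N) ->
  row_full (span_mx L) -> forall p, p \is i.-homog ->
  exists D, p = \sum_r D r *: span_row L r.
Proof.
move=> L1 wi /row_fullP[B BM] p hp.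
pose u : 'rV[k]_#|{: 'X_{1..n < i.+1}}| := \row_s p@_(enum_val s : 'X_{1..n < i.+1}).
exists (fun r => (u *m B) 0 (enum_rank r)).
apply/mpolyP => b; rewrite raddf_sum /=; have [bi|ib] := ltnP (mdeg b) i.+1; last first.
  rewrite (dhomog_nemf_coeff hp) ?gtn_eqF // big1 // => -[[j a]|e] _ /=; rewrite mcoeffZ.
    case: eqP => [ai|_]; last by rewrite mcoeff0 mulr0.
    have hL := dhomog_powX d a (L1 j); rewrite ai in hL.
    by rewrite (dhomog_nemf_coeff hL) ?mulr0 // gtn_eqF.
  case we: (w e); last by rewrite mcoeff0 mulr0.
  rewrite mcoeffX; case: eqP => [be|]; last by rewrite mulr0.
  by have := wi _ we; rewrite be leqNgt ib.
have := congr1 (fun M : 'rV_ _ => M 0 (enum_rank (BMultinom bi))) (mulmxA u B (span_mx L)).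
rewrite BM mulmx1 mxE enum_rankK /= => ->.
rewrite mxE (reindex (@enum_rank _)) /=; last exact/onW_bij/enum_rank_bij.
by apply: eq_bigr => r _; rewrite mcoeffZ [span_mx _ _ _]mxE !enum_rankK.
Qed.

Definition generic_linear_form (k : fieldType) (j : 'I_m) : {mpoly {mpoly k[m * n]}[n]} :=
  \sum_(l < n) 'X_(mxvec_index j l) *: 'X_l.

(** A maximal minor that is nonzero at [A0], taken for linear forms with indeterminate coefficients,
    is the required polynomial. *)
Lemma span_mx_open (k : fieldType) (A0 : 'M[k]_(m, n)) :
  row_full (span_mx (linear_form A0)) ->
  exists f : {mpoly k[m * n]}, f.@[fun l => mxvec A0 0 l] != 0 /\
    forall A, f.@[fun l => mxvec A 0 l] != 0 -> row_full (span_mx (linear_form A)).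
Proof.
move=> full; pose g := fullrankfun full.
have evE (A : 'M[k]_(m, n)) :
    (\det (rowsub g (span_mx (@generic_linear_form k)))).@[fun l => mxvec A 0 l]
    = \det (rowsub g (span_mx (linear_form A))).
  rewrite -det_map_mx map_mxsub map_span_mx; congr (\det (rowsub g (span_mx _))).
  apply/funext => j; rewrite /generic_linear_form raddf_sum; apply: eq_bigr => l _ /=.
  by rewrite map_mpolyZ map_mpolyX /= mevalXU mxvecE.
exists (\det (rowsub g (span_mx (@generic_linear_form k)))); split=> [|A]; rewrite evE.
  by rewrite -unitfE -unitmxE; exact: fullrowsub_unit.
rewrite -unitfE -unitmxE -row_full_unit => /eqP rk.
rewrite /row_full eqn_leq rank_leq_col -{1}rk mxrankS //.
exact: rowsub_sub.
Qed.
End SpanMatrix.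

Section IdealPart.
Variables (k : fieldType) (m n d i : nat) (L : 'I_m -> {mpoly k[n.+1]}).
Hypothesis L1 : forall j, L j \is 1.-homog.

Lemma in_idealM (f : 'I_m -> {mpoly k[n.+1]}) j p : in_ideal f (f j * p).
Proof.
exists (fun l => p *+ (l == j)); rewrite (bigD1 j) //= eqxx mulrC big1 ?addr0 // => l.
by move=> /negbTE ->; rewrite mul0r.
Qed.

(** The columns of [span_mx] range over all degrees up to [i], hence the selection of all monomials
    of lower degree. These vanish on projection to degree [i], where the ideal and the span of [ws]
    remain. *)
Lemma dim_ideal_part_ge (ws : seq 'X_{1..n.+1}) :
  all (fun b => mdeg b == i) ws ->
  row_full (span_mx d i (fun b => (mdeg b < i)%N || (b \in ws)) L) ->
  (\dim {: dhomog n.+1 k i} <= \dim (ideal_part (fun j => L j ^+ d) i) + size ws)%N.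
Proof.
move=> /allP wsi full.
pose proj p : dhomog n.+1 k i := DHomog (pihomogP mdeg i p).
pose W := <<[seq proj 'X_[b] | b <- ws]>>%VS.
set I := ideal_part _ i.
suff IW : (fullv <= I + W)%VS.
  apply: leq_trans (dimvS IW) _; apply: leq_trans (dimv_add_leqif I W) _.
  by rewrite leq_add2l -(size_map (fun b => proj 'X_[b])) dim_span.
apply/subvP => p _.
have [|D pE] := span_mx_fullP L1 _ full (dhomog_is_dhomog p).
  by move=> b /orP[/ltnW|/wsi /eqP ->].
have -> : p = \sum_r D r *: proj (span_row d (fun b => (mdeg b < i)%N || (b \in ws)) L r).
  apply/val_inj; rewrite raddf_sum /= -[LHS](pihomog_dE (dhomog_is_dhomog p)) [in LHS]pE.
  by rewrite raddf_sum; apply: eq_bigr => r _; exact: linearZ.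
apply: rpred_sum => -[[j a]|b] _; apply: rpredZ => /=.
  apply: (subvP (addvSl I W)); apply/ideal_partP => /=.
  case: eqP => [ai|_]; last by rewrite mulr0n pihomog0; exact: in_ideal0.
  have hL := dhomog_powX d a (L1 j); rewrite ai in hL.
  by rewrite mulr1n pihomog_dE //; exact: (in_idealM (fun j => L j ^+ d)).
apply: (subvP (addvSr I W)); have [bw|bw] := boolP ((b : 'X_{1..n.+1}) \in ws).
  by rewrite orbT mulr1n memv_span //; apply/mapP; exists (b : 'X_{1..n.+1}).
rewrite orbF; suff -> : proj ('X_[b] *+ (mdeg b < i)%N) = 0 by exact: mem0v.
apply/val_inj => /=; case: ltnP => bi; rewrite ?mulr0n ?pihomog0 //.
by rewrite mulr1n pihomogX /= ltn_eqF.
Qed.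

End IdealPart.

(** * Ideals generated by forms of equal degree *)

Section HomogeneousIdeal.
Variables (k : fieldType) (m n d : nat) (f : 'I_m -> {mpoly k[n.+1]}).
Hypothesis hf : forall j, f j \is d.-homog.
Implicit Types (p q : {mpoly k[n.+1]}).

(** This allows cofactors of a form in the ideal to be replaced by their homogeneous components. *)
Lemma pihomogM i p q : q \is d.-homog ->
  pihomog mdeg i (p * q) = if (d <= i)%N then pihomog mdeg (i - d) p * q else 0.
Proof.
move=> hq; elim/mpolyind: p => [|c b p _ _ IH].
  by rewrite mul0r !pihomog0 mul0r if_same.
rewrite mulrDl !pihomogD IH -scalerAl !linearZ /= pihomogX.
have hX : 'X_[b] * q \is (mdeg b + d).-homog by apply: dhomogM; rewrite ?dhomogX.
have [bi|bi] := eqVneq (mdeg b + d)%N i.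
  rewrite (pihomog_dE (mf := mdeg)) -?bi // leq_addl addnK eqxx.
  by rewrite mulrDl scalerAl.
rewrite (pihomog_ne0 bi hX) scaler0 add0r; case: leqP => // di.
by rewrite ifN ?scaler0 ?add0r //; apply: contraNneq bi => ->; rewrite subnK.
Qed.

Fact ideal_comb_subproof e (g : {ffun 'I_m -> dhomog n.+1 k e}) :
  \sum_j mpoly_of_dhomog (g j) * f j \is (e + d).-homog.
Proof. by apply: rpred_sum => j _; apply: dhomogM; [exact: dhomog_is_dhomog | exact: hf]. Qed.

(** Its image is the degree [e + d] part of the ideal, and its kernel consists of the syzygies with
    entries of degree [e]. *)
Definition ideal_comb e (g : {ffun 'I_m -> dhomog n.+1 k e}) : dhomog n.+1 k (e + d) :=
  DHomog (ideal_comb_subproof g).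

Fact ideal_comb_is_linear e : linear (@ideal_comb e).
Proof.
move=> c g h; apply/val_inj => /=; rewrite scaler_sumr -big_split.
by apply: eq_bigr => j _; rewrite !ffunE /= mulrDl scalerAl.
Qed.

HB.instance Definition _ e := GRing.isLinear.Build k _ _ _ (@ideal_comb e)
  (@ideal_comb_is_linear e).

Lemma ideal_part_limg e : ideal_part f (e + d) = limg (linfun (@ideal_comb e)).
Proof.
apply/vspaceP => p; apply/idP/idP.
  move/ideal_partP => [g pE]; apply/memv_imgP.
  exists [ffun j => DHomog (pihomogP mdeg e (g j))]; first exact: memvf.
  rewrite lfunE; apply/val_inj => /=.
  rewrite -[LHS](pihomog_dE (dhomog_is_dhomog p)) /= [in LHS]pE raddf_sum.
  apply: eq_bigr => j _; rewrite ffunE /=.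
  by rewrite (pihomogM (e + d) (g j) (hf j)) leq_addl addnK.
move=> /memv_imgP[g _ ->]; rewrite lfunE; apply/ideal_partP.
by exists (fun j => mpoly_of_dhomog (g j)).
Qed.

Lemma ideal_part_eq0 i : (i < d)%N -> ideal_part f i = 0%VS.
Proof.
move=> id; apply/eqP; rewrite -subv0; apply/subvP => p /ideal_partP[g pE].
rewrite memv0; apply/eqP/val_inj => /=.
rewrite -[LHS](pihomog_dE (dhomog_is_dhomog p)) /= [in LHS]pE raddf_sum big1 // => j _.
by rewrite /= (pihomogM i (g j) (hf j)) leqNgt id.
Qed.

Lemma dim_dhomog e : \dim {: dhomog n.+1 k e} = 'C(e + n, n).
Proof. by rewrite dimvf -[RHS]bin_sub ?leq_addl // addnK. Qed.

Lemma dim_dhomog_ffun e :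
  \dim {: {ffun 'I_m -> dhomog n.+1 k e}} = (m * 'C(e + n, n))%N.
Proof. by rewrite -dim_dhomog !dimvf -[m in RHS]card_ord. Qed.

Lemma dim_ideal_part_le e : (\dim (ideal_part f (e + d)) <= m * 'C(e + n, n))%N.
Proof.
rewrite ideal_part_limg -dim_dhomog_ffun -(limg_ker_dim (linfun (@ideal_comb e)) fullv).
exact: leq_addl.
Qed.

Lemma dim_ideal_part_eq e :
  (\dim (ideal_part f (e + d)) == m * 'C(e + n, n))%N
    = (lker (linfun (@ideal_comb e)) == 0%VS).
Proof.
rewrite ideal_part_limg -dim_dhomog_ffun -(limg_ker_dim (linfun (@ideal_comb e)) fullv).
by rewrite capfv -[X in X == _]add0n eqn_add2r eq_sym dimv_eq0.
Qed.

(** A nonzero syzygy of degree [e] times a power of [X_0] would be a nonzero syzygy of degree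
    [e']. *)
Lemma dim_ideal_part_eqW e e' : (e <= e')%N ->
  \dim (ideal_part f (e' + d)) = (m * 'C(e' + n, n))%N ->
  \dim (ideal_part f (e + d)) = (m * 'C(e + n, n))%N.
Proof.
move=> ee' /eqP; rewrite dim_ideal_part_eq => /eqP ker0.
apply/eqP; rewrite dim_ideal_part_eq -subv0; apply/subvP => g.
rewrite memv_ker lfunE /= => /eqP/(congr1 val)/= g0.
have hX : 'X_ord0 ^+ (e' - e) \is [in k[n.+1], (e' - e).-homog].
  by rewrite -[X in X.-homog]mul1n; apply: dhomogMn; rewrite dhomogX /= mdeg1.
have hgX j : mpoly_of_dhomog (g j) * 'X_ord0 ^+ (e' - e) \is e'.-homog.
  by rewrite -[X in X.-homog](subnKC ee'); apply: dhomogM; [exact: dhomog_is_dhomog | exact: hX].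
pose h := [ffun j => DHomog (hgX j)].
have : h \in lker (linfun (@ideal_comb e')).
  rewrite memv_ker lfunE; apply/eqP/val_inj => /=.
  transitivity ('X_ord0 ^+ (e' - e) * \sum_j mpoly_of_dhomog (g j) * f j).
    by rewrite mulr_sumr; apply: eq_bigr => j _; rewrite ffunE /= mulrCA mulrA mulrAC.
  by rewrite g0 mulr0.
rewrite ker0 !memv0 => /eqP/ffunP h0; apply/eqP/ffunP => j.
have /(congr1 val)/eqP := h0 j; rewrite !ffunE /= mulf_eq0 expf_eq0.
rewrite -(mleadc_eq0 'X_ord0) mleadXm mcoeffX eqxx oner_eq0 andbF orbF => /eqP gj.
exact/val_inj.
Qed.

(** Each monomial of degree [i + 1] is a variable times a monomial of degree [i]. *)
Lemma ideal_part_fullS i : ideal_part f i = fullv -> ideal_part f i.+1 = fullv.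
Proof.
move=> full; apply/eqP; rewrite eqEsubv subvf; apply/subvP => p _.
apply/ideal_partP; rewrite [X in in_ideal _ X]mpolyE.
rewrite big_seq; apply: (big_ind (in_ideal f)) => [||b]; first exact: in_ideal0.
  exact: in_idealD.
move=> /(dhomog_mf (dhomog_is_dhomog p)) /= bi; apply: in_idealZ.
have [l bl] : exists l, (U_(l) <= b)%MM.
  case: (pickP (fun l => b l != 0%N)) => [l bl|b0]; first by exists l; rewrite lep1mP.
  suff b00 : b = 0%MM by rewrite b00 mdeg0 in bi.
  by apply/mnmP => l; rewrite mnm0E; have /negbFE/eqP := b0 l.
have hb : 'X_[k, b - U_(l)] \is i.-homog.
  rewrite dhomogX /=; have := congr1 mdeg (submK bl).
  by rewrite mdegD mdeg1 bi addn1 => -[->].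
have /ideal_partP [g gE] : DHomog hb \in ideal_part f i by rewrite full memvf.
exists (fun j => 'X_l * g j); rewrite -(submK bl) mpolyXD mulrC.
by rewrite [X in _ * X]gE mulr_sumr; apply: eq_bigr => j _; rewrite mulrA.
Qed.

End HomogeneousIdeal.

(** * The coefficients of the predicted series *)

Section Froberg.
Import Order.TTheory Num.Theory.

(** The hockey stick identity, which is multiplication by [1 / (1 - t)]. *)
Lemma sum_bin e i : (\sum_(j < i.+1) 'C(i - j + e, e) = 'C(i + e.+1, e.+1))%N.
Proof.
rewrite (reindex_inj rev_ord_inj) /=.
under eq_bigr => j _ do rewrite subSS subKn -1?ltnS //.
elim: i => [|i IH]; first by rewrite big_ord1 !add0n !binn.
by rewrite big_ord_recr /= IH [in RHS]addSn [in RHS]binS addSnnS.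
Qed.

Lemma ps_exp1E e i : ps_exp (fun=> 1) e.+1 i = 'C(i + e, e)%:Z.
Proof.
elim: e i => [|e IH] i.
  rewrite /ps_exp /= /ps_mul big_ord_recr big1 => [|j _] /=; first by rewrite subnn bin0.
  by rewrite subn_eq0 leqNgt ltn_ord mulr0.
rewrite -[ps_exp _ _]/(ps_mul (fun=> 1) (ps_exp (fun=> 1) e.+1)) /ps_mul.
rewrite -sum_bin -natz natr_sum; apply: eq_bigr => j _.
by rewrite IH mul1r natz.
Qed.

(** Two terms suffice, since the truncation takes place below degree [2d]. *)
Lemma expr_1subXn (d n : nat) :
  exists Q : {poly int}, (1 - 'X^d) ^+ n = 1 - n%:R * 'X^d + 'X^(d.*2) * Q.
Proof.
elim: n => [|n [Q IH]]; first by exists 0; rewrite expr0 mul0r subr0 mulr0 addr0.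
exists (n%:R + Q - 'X^d * Q).
by rewrite exprS IH -addnn exprD -(natr1 n); ring.
Qed.

Lemma coef_1subXn (d n j : nat) : (0 < d)%N -> (j < d.*2)%N ->
  ((1 - 'X^d) ^+ n : {poly int})`_j = (j == 0%N)%:R - n%:R * (j == d)%:R.
Proof.
move=> d0 jd; have [Q ->] := expr_1subXn d n.
rewrite coefD coefB coef1 coefXnM jd addr0; congr (_ - _).
by rewrite !mulr_natl coefMn coefXn.
Qed.

(** The dimension of the quotient in degree [i] when the eight generators have no syzygies there. *)
Definition froberg_coef (d i : nat) : int :=
  'C(i + 3, 3)%:Z - 8 * (if (d <= i)%N then 'C(i - d + 3, 3) else 0%N)%:Z.

Lemma froberg_ratioE d i : (0 < d)%N -> (i < d.*2)%N ->
  froberg_ratio 4 8 d i = froberg_coef d i.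
Proof.
move=> d0 id; rewrite /froberg_ratio /ps_mul.
transitivity (\sum_(j < i.+1) (((j : nat) == 0%N)%:R * 'C(i - j + 3, 3)%:Z
    - 8 * (((j : nat) == d)%:R * 'C(i - j + 3, 3)%:Z))).
  apply: eq_bigr => j _; rewrite coef_1subXn // ?ps_exp1E ?mulrBl ?mulrA //.
  exact: leq_ltn_trans (leq_ord j) id.
rewrite sumrB -mulr_sumr /froberg_coef; congr (_ - 8 * _).
  by rewrite big_ord_recl big1 ?addr0 /= ?mul1r ?subn0 // => j _; rewrite mul0r.
case: leqP => di; last first.
  by rewrite big1 // => j _; rewrite ltn_eqF ?mul0r // (leq_ltn_trans (leq_ord j)).
rewrite (bigD1 (Ordinal (di : (d < i.+1)%N))) //= eqxx mul1r big1 ?addr0 // => j jd.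
by rewrite (negbTE (_ : (j : nat) != d)) ?mul0r.
Qed.

(** Clearing the denominator turns comparisons of binomials into polynomial ones. *)
Lemma bin3E x : ('C(x + 3, 3) * 6 = (x + 3) * (x + 2) * (x + 1))%N.
Proof.
have := bin_ffact (x + 3) 3; rewrite !ffactnS ffactn0 => ->.
by rewrite addn3 addn2 addn1 /= muln1 mulnA.
Qed.

Lemma froberg_coef_gt0 d i : (0 < d)%N -> (i.+1 < d.*2)%N -> 0 < froberg_coef d i.
Proof.
move=> d0 id; rewrite /froberg_coef; have := bin3E i.
case: leqP => di; last by nia.
have := bin3E (i - d); have [e iE] : exists e, i = (e + d)%N by exists (i - d)%N; lia.
move: id; rewrite {}iE {i di} addnK => id.
(* Here [d >= e + 2]. The next inequality is strict because [(2e + 5)(2e + 3)] exceeds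
   [(2e + 6)(2e + 2)] by 3. *)
have mono : ((e.*2 + 5) * (e.*2 + 4) * (e.*2 + 3) <=
    (e + d + 3) * (e + d + 2) * (e + d + 1))%N.
  by rewrite !leq_mul //; lia.
have : (8 * ((e + 3) * (e + 2) * (e + 1)) < (e.*2 + 5) * (e.*2 + 4) * (e.*2 + 3))%N by nia.
lia.
Qed.

(** For [d = e + 2], six times the coefficient is [(2e + 4)((2e + 5)(2e + 3) - (2e + 6)(2e + 2)) = 6
    (e + 2)]. *)
Lemma froberg_coef_top d : (0 < d)%N -> froberg_coef d (d.*2 - 2) = d%:Z.
Proof.
case: d => [//|[|e]] _ //; rewrite /froberg_coef.
have -> : (e.+2.*2 - 2 = e + e.+2)%N by lia.
rewrite leq_addl addnK; have := bin3E e; have := bin3E (e + e.+2).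
nia.
Qed.

(** For [d = e + 1], six times the coefficient is [(2e + 4)(2e + 2)((2e + 3) - (2e + 6))]. *)
Lemma froberg_coef_le0 d : (0 < d)%N -> froberg_coef d d.*2.-1 <= 0.
Proof.
case: d => [//|e] _; rewrite /froberg_coef.
have -> : (e.+1.*2.-1 = e + e.+1)%N by lia.
rewrite leq_addl addnK; have := bin3E e; have := bin3E (e + e.+1).
nia.
Qed.

Lemma froberg_low d i : (0 < d)%N -> (i.+1 < d.*2)%N -> froberg 4 8 d i = froberg_coef d i.
Proof.
move=> d0 id; rewrite /froberg /truncate; case: ifP => [_|/negP[]].
  by rewrite froberg_ratioE // ltnW.
apply/forallP => j; have ji := leq_ord j.
by rewrite froberg_ratioE ?froberg_coef_gt0 //; lia.
Qed.

Lemma froberg_high d i : (0 < d)%N -> (d.*2 <= i.+1)%N -> froberg 4 8 d i = 0.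
Proof.
move=> d0 di; rewrite /froberg /truncate ifF //; apply/negP => /forallP pos.
have jP : (d.*2.-1 < i.+1)%N by lia.
have := pos (Ordinal jP); rewrite /= froberg_ratioE //; last by lia.
by rewrite ltNge froberg_coef_le0.
Qed.

End Froberg.

(** * The eight points *)

Section Quadrilateral.
Variable (k : fieldType).
Hypothesis natk0 : forall n, (n%:R == 0 :> k) = (n == 0)%N.

Definition var (l : nat) : 'I_4 := inord l.

(** Two points on each of the four sides joining [e_0] or [e_2] to [e_1] or [e_3]. *)
Definition quad_dirs : seq ('I_4 -> k) :=
  [:: dir (var 2) (var 1) 1 1; dir (var 2) (var 1) 1 (-1);
      dir (var 2) (var 3) 2%:R 1; dir (var 2) (var 3) 2%:R (-1);
      dir (var 0) (var 1) 1 1; dir (var 0) (var 1) 1 (-1);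
      dir (var 0) (var 3) 1 1; dir (var 0) (var 3) 1 (-1)].

Definition quad_dir (j : nat) : 'I_4 -> k := nth (fun=> 0) quad_dirs j.

(** With [2 e2 +- e3] in place of [e2 +- e3], the ratio in [eq_bisum_top] is [4], not
    [1]. *)
Definition quad_mx : 'M[k]_(8, 4) := \matrix_(j, l) quad_dir j l.

Definition quad_mnm (m j : nat) : 'X_{1..4} :=
  ((U_(var 0) + U_(var 2)) *+ j + (U_(var 1) + U_(var 3)) *+ (m - j))%MM.

Definition quad_mnms (m : nat) := [seq quad_mnm m j | j <- iota 0 m.+1].

Lemma mdeg_quad_mnm m j : (j <= m)%N -> mdeg (quad_mnm m j) = m.*2.
Proof.
move=> jm; rewrite mdegD !mdegMn !mdegD !mdeg1 -mulnDr subnKC //.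
by rewrite mul2n.
Qed.

(** Apolarity gives the degree bounds at the eight points, and [space_form] concludes. It is used
    for [e = 2m] and [e = 2m + 1]. *)
Lemma quad_dual_poly m e c : (m.*2 <= e)%N ->
  (forall j b, (mdeg b + m.+1 = e)%N ->
    pairing e.+1 c (linear_form quad_mx j ^+ m.+1 * 'X_[b]) = 0) ->
  exists u : nat -> k, dual_poly e c = \sum_(j < m.+1) u j *: 'X_[quad_mnm m j].
Proof.
move=> me cP.
have ds j : (j < 8)%N -> (dirsize (quad_dir j) (dual_poly e c) <= m.+1)%N.
  move=> j8; apply: (dirsize_dual_poly natk0) => b be.
  have -> : \sum_l quad_dir j l *: 'X_l = linear_form quad_mx (Ordinal j8).
    by apply: eq_bigr => l _; rewrite mxE.
  exact: cP.
have oF : order_ge m.*2 (dual_poly e c).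
  move=> b bm; apply: (dhomog_nemf_coeff (dual_poly_homog e c)).
  by rewrite neq_ltn (leq_trans bm).
have u4 : uniq [:: var 0; var 2; var 1; var 3].
  by rewrite /= !inE -!val_eqE /= !inordK.
have [||||u uE] := space_form natk0 u4 oF.
- by split; [exact: (ds 0%N) | exact: (ds 1%N)].
- by split; [exact: (ds 2) | exact: (ds 3)].
- by split; [exact: (ds 4) | exact: (ds 5)].
- by split; [exact: (ds 6) | exact: (ds 7)].
exists u; rewrite uE; apply: eq_bigr => j _.
by rewrite -!mpolyXD !mpolyXn -mpolyXD.
Qed.

(** The dual polynomial is supported on [quad_mnms m], where the functional is required to
    vanish. *)
Lemma row_full_quad m :
  row_full (span_mx m.+1 m.*2 (fun b => (mdeg b < m.*2)%N || (b \in quad_mnms m))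
    (linear_form quad_mx)).
Proof.
apply: span_mx_full => c cP cw b; rewrite leq_eqVlt => /orP[/eqP bm|bm]; last first.
  by apply: cw; rewrite ?bm // ltnW.
have [u uE] := quad_dual_poly (leqnn _) cP.
have [bw|bw] := boolP (b \in quad_mnms m).
  by apply: cw; rewrite ?bw ?orbT // bm.
apply: (dual_poly_eq0 natk0 bm); rewrite uE raddf_sum /= big1 // => j _.
rewrite mcoeffZ mcoeffX; case: eqP => [bj|]; last by rewrite mulr0.
by case/mapP: bw; exists (j : nat); rewrite ?mem_iota ?add0n /=.
Qed.

(** A form of degree [2m + 1] that is a combination of monomials of degree [2m] is zero. *)
Lemma row_full_quadS m :
  row_full (span_mx m.+1 m.*2.+1 (fun b => (mdeg b < m.*2.+1)%N || (b \in [::]))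
    (linear_form quad_mx)).
Proof.
apply: span_mx_full => c cP cw b; rewrite leq_eqVlt => /orP[/eqP bm|bm]; last first.
  by apply: cw; rewrite ?bm // ltnW.
have [u uE] := quad_dual_poly (leqnSn _) cP.
apply: (dual_poly_eq0 natk0 bm); rewrite uE raddf_sum /= big1 // => j _.
rewrite mcoeffZ mcoeffX; case: eqP => [bj|]; last by rewrite mulr0.
move: bm; rewrite -bj mdeg_quad_mnm => [/eqP|]; last by rewrite -ltnS.
by rewrite ltn_eqF.
Qed.

End Quadrilateral.

(** * The Hilbert function for eight general linear forms *)

Lemma linear_form_homog (k : fieldType) m n (A : 'M[k]_(m, n)) j :
  linear_form A j \is 1.-homog.
Proof. by apply: rpred_sum => l _; apply: rpredZ; rewrite dhomogX /= mdeg1. Qed.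

Section Hilbert.
Variables (k : fieldType) (d : nat) (A : 'M[k]_(8, 4)).
Hypothesis d0 : (0 < d)%N.
Let f j := linear_form A j ^+ d.

Let hf j : f j \is d.-homog.
Proof. by rewrite -[d in d.-homog]mul1n; apply: dhomogMn; exact: linear_form_homog. Qed.

Lemma hilbert_low i :
  ('C(d.*2 - 2 + 3, 3) <= \dim (ideal_part f (d.*2 - 2)) + d)%N ->
  (i.+1 < d.*2)%N -> (hilbert_fun f i)%:Z = froberg_coef d i.
Proof.
move=> dim_top id; rewrite /hilbert_fun dim_dhomog /froberg_coef.
have := froberg_coef_gt0 d0 id; rewrite /froberg_coef.
case: leqP => di; last by rewrite (ideal_part_eq0 hf di) dimv0 subn0 mulr0 subr0.
have d2 : (2 <= d)%N by lia.
(* The codimension bound and [froberg_coef_top] give the lower estimate, the number of products the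
   upper one. Equality excludes syzygies here, hence in all lower degrees. *)
have top : \dim (ideal_part f (d - 2 + d)) = (8 * 'C(d - 2 + 3, 3))%N.
  have dE : (d.*2 - 2 = d - 2 + d)%N by lia.
  have := dim_ideal_part_le hf (d - 2); have := froberg_coef_top d0; move: dim_top.
  by rewrite /froberg_coef dE leq_addl addnK; lia.
have id2 : (i - d <= d - 2)%N by lia.
have := dim_ideal_part_eqW hf id2 top; rewrite subnK // => ->.
by lia.
Qed.

Lemma hilbert_high i :
  ideal_part f d.*2.-1 = fullv -> (d.*2 <= i.+1)%N -> hilbert_fun f i = 0%N.
Proof.
move=> full_above di; suff full : ideal_part f i = fullv by rewrite /hilbert_fun full subnn.
have -> : i = (i.+1 - d.*2 + d.*2.-1)%N by lia.
elim: (i.+1 - d.*2)%N => [|e IH]; first exact: full_above.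
by rewrite addSn; exact: ideal_part_fullS IH.
Qed.

End Hilbert.

Theorem proposition8p6 (k : fieldType) (hk : [pchar k] =i pred0)
    (d : nat) (hd : (1 <= d)%N) :
  general (fun A : 'M[k]_(8, 4) =>
    let H := hilbert_fun (fun j => linear_form A j ^+ d) in
    (forall i, (H i)%:Z = froberg 4 8 d i) /\
    (exists P : {poly int},
      [/\ forall i, P`_i = (H i)%:Z,
          size P = (2 * (d - 1)).+1 &
          lead_coef P = d%:Z])).
Proof.
have natk0 n : (n%:R == 0 :> k) = (n == 0)%N by exact: (pcharf0P k).1 hk n.
have [m dE] : exists m, d = m.+1 by exists d.-1; rewrite prednK.
have [f1 [f1A f1P]] := span_mx_open (row_full_quad natk0 m).
have [f2 [f2A f2P]] := span_mx_open (row_full_quadS natk0 m).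
pose ev A (f : {mpoly k[8 * 4]}) := f.@[fun i => mxvec A 0 i].
(* The open set where both minors are nonzero contains [quad_mx]. *)
exists (fun A => ev A (f1 * f2) != 0); split.
- exists (fun f => f = f1 * f2) => A; split=> [fA|[f -> //]].
  by exists (f1 * f2).
- by exists (quad_mx k); rewrite /ev mevalM mulf_neq0.
move=> A; rewrite /ev mevalM mulf_eq0 negb_or => /andP[/f1P full1 /f2P full2].
set H := hilbert_fun _.
have L1 := linear_form_homog A.
(* The list [quad_mnms m] has [m + 1 = d] members, which bounds the codimension. *)
have dim_top : ('C(d.*2 - 2 + 3, 3) <=
    \dim (ideal_part (fun j => linear_form A j ^+ d) (d.*2 - 2)) + d)%N.
  have := dim_ideal_part_ge L1 _ full1; rewrite dim_dhomog size_map size_iota -dE.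
  have -> : m.*2 = (d.*2 - 2)%N by rewrite dE; lia.
  apply; apply/allP => b /mapP[j]; rewrite mem_iota add0n => /andP[_ jm] ->.
  by rewrite mdeg_quad_mnm ?dE //; lia.
have full_above : ideal_part (fun j => linear_form A j ^+ d) d.*2.-1 = fullv.
  have := dim_ideal_part_ge L1 (ws := [::]) isT full2; rewrite addn0 -dE.
  have -> : m.*2.+1 = d.*2.-1 by rewrite dE; lia.
  by move=> le; apply/eqP; rewrite eqEdim subvf.
have low i : (i.+1 < d.*2)%N -> (H i)%:Z = froberg_coef d i by exact: hilbert_low.
have high i : (d.*2 <= i.+1)%N -> H i = 0%N by exact: hilbert_high.
split=> [i|].
  have [id|di] := ltnP i.+1 d.*2; first by rewrite froberg_low // low.
  by rewrite froberg_high // high.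
pose P : {poly int} := \poly_(i < d.*2.-1) (H i)%:Z.
have PE i : P`_i = (H i)%:Z.
  rewrite coef_poly; case: ltnP => // di.
  by rewrite high //; lia.
have sP : size P = (2 * (d - 1)).+1.
  rewrite size_poly_eq; first by lia.
  have -> : d.*2.-2 = (d.*2 - 2)%N by lia.
  by rewrite low ?froberg_coef_top //; lia.
exists P; split=> //; rewrite lead_coefE sP PE /=.
have -> : (2 * (d - 1) = d.*2 - 2)%N by lia.
by rewrite low ?froberg_coef_top //; lia.
Qed.
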